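(* Let $F:x\in\mathbb{R}^{\tilde d}\mapsto q_A(x)+\sum_{i=1}^{\tilde d}\psi_i(x^{(i)})$, where each $\psi_i$ is convex, and suppose that: $q_A$ satisfies, for some $\sigma_A\ge0$ and all $x,y\in\mathbb{R}^{\tilde d}$, $$q_A(x)-q_A(y)\ge\nabla q_A(y)^\top A^\dagger A(x-y)+\tfrac{\sigma_A}{2}(x-y)^\top A^\dagger A(x-y),$$ and, for some matrix $M$ and all $x,y$, $$q_A(x)-q_A(y)\le\nabla q_A(y)^\top A^\dagger A(x-y)+\tfrac12(x-y)^\top M(x-y);$$ and that for every $i\in\{1,\dots,\tilde d\}$ either $R_i:=e_i^\top A^\dagger Ae_i=1$ or $\psi_i=0$. If $S$ is such that $S^2\ge\lambda_{\max}(A^\dagger AP_b^\dagger MP_b^\dagger A^\dagger A)$ for all blocks $b$, and $1-\beta_t-\frac{\alpha_t}{p_i}\ge0$ for all $t$ and all $i$ such that $\psi_i\ne0$, then the sequences $v_t$ and $x_t$ generated by the generalized APCG algorithm satisfy $$B_t\,\mathbb{E}\left[\|v_t-\theta^\star\|^2_{A^\dagger A}\right]+2A_t\left[\mathbb{E}[F(x_t)]-F(\theta^\star)\right]\le C_0,$$ where $C_0=B_0\|v_0-\theta^\star\|^2+2A_0[F(x_0)-F(\theta^\star)]$ and $\theta^\star$ is a minimizer of $F$.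
   Context: $A$ is a matrix with $\tilde d$ columns, $A^\dagger$ its pseudo-inverse, so $A^\dagger A$ is the orthogonal projector onto $\mathrm{Ker}(A)^\perp$. $e_i\in\mathbb{R}^{\tilde d}$ is the $i$-th unit vector, $x^{(i)}=e_i^\top x$, $\|x\|_Q^2=x^\top Qx$, and $\mathrm{prox}_{\eta f}(x)=\arg\min_v\frac1{2\eta}\|v-x\|^2+f(v)$. Sampling: at each step a block $b\subset\{1,\dots,\tilde d\}$ is drawn (independently of the past) with probability $p_b$; $p_i=\sum_{b\ni i}p_b>0$. $P_b$ is the diagonal matrix with $(P_b)_{ii}=p_i$ if $i\in b$ and $0$ otherwise; $P_b^\dagger$ is its pseudo-inverse. Sequences: given $A_0,B_0\in\mathbb{R}$, the sequences $a_t,A_t,B_t,\alpha_t,\beta_t$ are defined recursively by $a_{t+1}^2S^2=A_{t+1}B_{t+1}$ (positive root $a_{t+1}$), $B_{t+1}=B_t+\sigma_Aa_{t+1}$, $A_{t+1}=A_t+a_{t+1}$, $\alpha_t=a_{t+1}/A_{t+1}$, $\beta_t=\sigma_Aa_{t+1}/B_{t+1}$, and $\eta_t=a_{t+1}/B_{t+1}$. Generalized APCG algorithm: $x_0=y_0=v_0=0$ and, for $t\ge0$: - $y_t=\frac{(1-\alpha_t)x_t+\alpha_t(1-\beta_t)v_t}{1-\alpha_t\beta_t}$; - sample $b=b_t$ with probability $p_{b_t}$; - $v_{t+\frac12}=(1-\beta_t)v_t+\beta_ty_t-\eta_tP_b^\dagger\nabla q_A(y_t)$; - $v_{t+1}^{(i)}=\mathrm{prox}_{\eta_tp_i^{-1}\psi_i}\big(v_{t+\frac12}^{(i)}\big)$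 for $i\in b$, and $v_{t+1}^{(i)}=v_{t+\frac12}^{(i)}$ for $i\notin b$; - $x_{t+1}=y_t+\alpha_tP_b^\dagger A^\dagger A\big(v_{t+1}-(1-\beta_t)v_t-\beta_ty_t\big)$.
   Formalization: The formal theorem adds that $B_0\ge 0$ and that the matrix $M$ is symmetric; without either of these the claim as stated is false. *)

(* Defs.v *)
From HB Require Import structures.
From mathcomp Require Import all_boot all_order all_algebra.
From mathcomp Require Import all_classical all_reals all_analysis.

Set Implicit Arguments.
Unset Strict Implicit.
Unset Printing Implicit Defensive.

Import Order.TTheory GRing.Theory Num.Theory.
Import numFieldNormedType.Exports.

Local Open Scope classical_set_scope.
Local Open Scope ring_scope.

(* MathComp's [pinvmx] is only a partial inverse; the Moore-Penrose
   pseudo-inverse is the matrix singled out by the four Penrose equations. *)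
Definition moore_penrose {R : realType} {m n : nat}
    (A : 'M[R]_(m, n)) (X : 'M[R]_(n, m)) : Prop :=
  [/\ A *m X *m A = A, X *m A *m X = X,
      (A *m X)^T = A *m X & (X *m A)^T = X *m A].

Definition pseudoinv {R : realType} {m n : nat} (A : 'M[R]_(m, n)) :
    'M[R]_(n, m) :=
  xget 0 [set X | moore_penrose A X].

Lemma moore_penrose_uniq {R : realType} {m n : nat}
    (A : 'M[R]_(m, n)) (X Y : 'M[R]_(n, m)) :
  moore_penrose A X -> moore_penrose A Y -> X = Y.
Proof.
move=> [AXA XAX sAX sXA] [AYA YAY sAY sYA].
have AXY : A *m X = A *m Y.
  rewrite -sAX -{1}AYA -[A *m Y *m A *m X]mulmxA trmx_mul sAX sAY.
  by rewrite mulmxA AXA.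
have XAY : X *m A = Y *m A.
  rewrite -sXA -{1}AYA -[A *m Y *m A]mulmxA mulmxA trmx_mul sXA sYA.
  by rewrite -mulmxA [A *m (X *m A)]mulmxA AXA.
by rewrite -XAX XAY -mulmxA AXY mulmxA YAY.
Qed.

Lemma gram_unitmx {R : realType} {r n : nat} (B : 'M[R]_(r, n)) :
  row_free B -> B *m B^T \in unitmx.
Proof.
move=> Bfree; rewrite -row_free_unit -kermx_eq0; apply/eqP/row_matrixP => i.
rewrite row0; set u := row i _.
have uG : u *m (B *m B^T) = 0.
  by apply/sub_kermxP; rewrite /u row_sub.
have u0 : (u *m B) *m (u *m B)^T = 0.
  by rewrite trmx_mul mulmxA -[u *m B *m B^T]mulmxA uG mul0mx.
have uB0 : u *m B = 0.
  move: u0; move: (u *m B) => z /matrixP/(_ 0 0); rewrite !mxE => z0.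
  apply/rowP => j; rewrite mxE; apply/eqP; rewrite -sqrf_eq0; apply/eqP.
  apply: (@psumr_eq0P _ _ predT (fun k => z 0 k ^+ 2)) => //.
    by move=> k _; exact: sqr_ge0.
  by rewrite -[RHS]z0; apply: eq_bigr => k _; rewrite mxE expr2.
by apply/eqP; rewrite -(mulmx_free_eq0 _ Bfree) uB0.
Qed.

Lemma pseudoinvP {R : realType} {m n : nat} (A : 'M[R]_(m, n)) :
  moore_penrose A (pseudoinv A).
Proof.
set C := col_base A; set D := row_base A.
have defA : A = C *m D by rewrite mulmx_base.
have uD : D *m D^T \in unitmx by rewrite gram_unitmx// row_base_free.
have uC : C^T *m C \in unitmx.
  by rewrite -{2}[C]trmxK gram_unitmx// /row_free mxrank_tr; exact: col_base_full.
move: C D defA uD uC => C D defA uD uC.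
pose X := D^T *m invmx (D *m D^T) *m (invmx (C^T *m C) *m C^T).
suff AX : moore_penrose A X.
  by rewrite /pseudoinv; case: xgetP => [Y -> //|/(_ X)].
have DX : D *m X = invmx (C^T *m C) *m C^T.
  by rewrite /X !mulmxA mulmxV// mul1mx.
have XC : X *m C = D^T *m invmx (D *m D^T).
  by rewrite /X -!mulmxA mulVmx// ?mul1mx ?mulmx1.
have sG r (G : 'M[R]_r) : G^T = G -> (invmx G)^T = invmx G.
  by move=> GT; rewrite trmx_inv GT.
split.
- by rewrite defA -[C *m D *m X]mulmxA DX mulmxA -!(mulmxA C) -(mulmxA _ C^T)
    mulVmx// ?mul1mx ?mulmx1.
- by rewrite defA [X *m (C *m D)]mulmxA XC -[_ *m D *m X]mulmxA DX.
- rewrite defA -[C *m D *m X]mulmxA DX mulmxA 2!trmx_mul trmxK sG ?mulmxA//.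
  by rewrite trmx_mul trmxK.
- rewrite defA [X *m (C *m D)]mulmxA XC 2!trmx_mul trmxK sG ?mulmxA//.
  by rewrite trmx_mul trmxK.
Qed.

Definition ker_proj {R : realType} {m n : nat} (A : 'M[R]_(m, n)) : 'M[R]_n :=
  pseudoinv A *m A.

Definition sqnorm {R : realType} {n : nat} (Q : 'M[R]_n) (x : 'cV[R]_n) : R :=
  (x^T *m Q *m x) 0 0.

(* Only meant for symmetric matrices, whose eigenvalues are all real. *)
Definition lambda_max {R : realType} {n : nat} (W : 'M[R]_n) : R :=
  sup [set a | eigenvalue W a].

Definition gradient {R : realType} {n : nat} (q : 'cV[R]_n -> R) (y : 'cV[R]_n) :
    'cV[R]_n :=
  \col_i 'D_(delta_mx i 0) (q : 'cV[R]_n -> R^o) y.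

Definition is_minimizer {R : realType} {T : Type} (f : T -> R) (x : T) : Prop :=
  forall z, f x <= f z.

(* v = prox_{eta f}(x) *)
Definition is_prox {R : realType} (eta : R) (f : R -> R) (x v : R) : Prop :=
  is_minimizer (fun u => (2 * eta)^-1 * (u - x) ^+ 2 + f u) v.

Definition composite {R : realType} {d : nat} (q : 'cV[R]_d -> R)
    (psi : 'I_d -> R -> R) (x : 'cV[R]_d) : R :=
  q x + \sum_i psi i (x i 0).

(* p b is the probability of drawing the block b *)
Definition coord_prob {R : realType} {d : nat} (p : {set 'I_d} -> R) (i : 'I_d) :
    R :=
  \sum_(b : {set 'I_d} | i \in b) p b.

Definition block_mx_of {R : realType} {d : nat} (p : {set 'I_d} -> R)
    (b : {set 'I_d}) : 'M[R]_d :=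
  diag_mx (\row_i (if i \in b then coord_prob p i else 0)).

(* The random blocks b_0, b_1, ... have law p, and each b_t is independent of
   (b_0, ..., b_{t-1}). *)
Record block_sampling {R : realType} {dO : measure_display}
    {Omega : measurableType dO} (P : probability Omega R) {d : nat}
    (p : {set 'I_d} -> R) (b : nat -> Omega -> {set 'I_d}) : Prop := {
  block_measurable : forall t c, measurable [set w | b t w = c];
  block_law : forall t c, P [set w | b t w = c] = (p c)%:E;
  block_indep : forall t (h : nat -> {set 'I_d}),
    P [set w | forall s, (s <= t)%N -> b s w = h s] =
    (P [set w | forall s, (s < t)%N -> b s w = h s] *
     P [set w | b t w = h t])%E }.

(* The value a 0 plays no role.  The two nonvanishing conditions say that the
   quotients defining alpha_t, beta_t and eta_t make sense. *)
Record apcg_coefficients {R : realType} (sigma S : R)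
    (a A B alpha beta eta : nat -> R) : Prop := {
  coef_a_gt0 : forall t, 0 < a t.+1;
  coef_a_eq : forall t, a t.+1 ^+ 2 * S ^+ 2 = A t.+1 * B t.+1;
  coef_B : forall t, B t.+1 = B t + sigma * a t.+1;
  coef_A : forall t, A t.+1 = A t + a t.+1;
  coef_A_neq0 : forall t, A t.+1 != 0;
  coef_B_neq0 : forall t, B t.+1 != 0;
  coef_alpha : forall t, alpha t = a t.+1 / A t.+1;
  coef_beta : forall t, beta t = sigma * a t.+1 / B t.+1;
  coef_eta : forall t, eta t = a t.+1 / B t.+1 }.

(* A run of the algorithm along the sequence of blocks b; vh t is v_{t+1/2}.
   The formula for y_t at t = 0 gives 0 even when 1 - alpha_0 beta_0 = 0, since
   x_0 = v_0 = 0. *)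
Record apcg_run {R : realType} {m d : nat} (A : 'M[R]_(m, d))
    (q : 'cV[R]_d -> R) (psi : 'I_d -> R -> R) (p : {set 'I_d} -> R)
    (alpha beta eta : nat -> R) (b : nat -> {set 'I_d})
    (x y v vh : nat -> 'cV[R]_d) : Prop := {
  run_x0 : x 0%N = 0;
  run_y0 : y 0%N = 0;
  run_v0 : v 0%N = 0;
  run_y : forall t, y t = (1 - alpha t * beta t)^-1 *:
    ((1 - alpha t) *: x t + (alpha t * (1 - beta t)) *: v t);
  run_vh : forall t, vh t = (1 - beta t) *: v t + beta t *: y t
    - eta t *: (pseudoinv (block_mx_of p (b t)) *m gradient q (y t));
  run_v_in : forall t i, i \in b t ->
    is_prox (eta t * (coord_prob p i)^-1) (psi i) (vh t i 0) (v t.+1 i 0);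
  run_v_out : forall t i, i \notin b t -> v t.+1 i 0 = vh t i 0;
  run_x : forall t, x t.+1 = y t + alpha t *:
    (pseudoinv (block_mx_of p (b t)) *m ker_proj A *m
     (v t.+1 - (1 - beta t) *: v t - beta t *: y t)) }.

(* Main.v *)
Require Import Defs.
From HB Require Import structures.
From mathcomp Require Import all_boot all_order all_algebra.
From mathcomp Require Import all_classical all_reals all_analysis.
From mathcomp Require Import ring lra.

Set Implicit Arguments.
Unset Strict Implicit.
Unset Printing Implicit Defensive.

Import Order.TTheory GRing.Theory Num.Theory.
Import numFieldNormedType.Exports.

Local Open Scope classical_set_scope.
Local Open Scope ring_scope.

(* The Lyapunov function is
     B_t |v_t - theta|^2 + 2 A_t (q (x_t) + sum_i h_t,i - F theta)
   (norm taken in the seminorm of the projector), where h_t,i >= psi_i (x_t,i)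
   comes from writing x_t,i as a convex combination of v_0,i, ..., v_t,i; the step
   condition is what makes the weights nonnegative.  For a fixed past it decreases
   in mean over the next block: with g_i the generalized gradient of the proximal
   step, the descent bound on q and the expansion of the norm leave a quadratic
   term <P_b^+ (g - grad q), P_b^+ g>, and as g - grad q lives on coordinates fixed by
   the projector this term turns w_i into the proximal point in the subgradient
   inequality of psi_i.  As [v_t] and [x_t] are functions of the finitely many
   possible values of (b_0, ..., b_{t-1}), all expectations are finite sums. *)

(** * Quadratic forms and the projector *)

(** The obstacle is the non-smooth part. In a coordinate [i] fixed by the projector the update is x'
    = y + (alpha / p_i) (v' - w), with w = (1 - beta) v + beta y, which is not an average of y and
    v': the old point v enters through w with a negative coefficient. That coefficient has to be
    absorbed by the weight which v already carries in x and y. The weight in x_t is exactly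
    alpha_(t-1) / p_i, hence the need to carry it along and to compare consecutive values of alpha.
    The constant S enters through alpha eta S^2 = 1: the curvature term of the descent bound then
    equals the quadratic term of the expanded norm, and their sum combines with the gradient term
    into a single defect. The mean over a block compares with a virtual update of all coordinates. A
    run only provides proximal points for drawn coordinates; since p_i > 0, every past of positive
    probability has a continuation that draws [i], and that continuation provides the missing
    point. *)

Lemma cV_addE {V : nmodType} {n : nat} (u v : 'cV[V]_n) i :
  (u + v) i 0 = u i 0 + v i 0.
Proof. exact: mxE. Qed.

Lemma cV_oppE {V : zmodType} {n : nat} (u : 'cV[V]_n) i : (- u) i 0 = - u i 0.
Proof. exact: mxE. Qed.

Lemma cV_scaleE {R : pzRingType} {n : nat} (k : R) (u : 'cV[R]_n) i :
  (k *: u) i 0 = k * u i 0.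
Proof. exact: mxE. Qed.

Definition cVE := (@cV_addE, @cV_oppE, @cV_scaleE).

Definition bilform {R : realType} {n : nat} (Q : 'M[R]_n) (u v : 'cV[R]_n) : R :=
  (u^T *m Q *m v) 0 0.

Section bilform.
Context {R : realType} {n : nat}.
Implicit Types (Q : 'M[R]_n) (u v w : 'cV[R]_n) (k : R).

Lemma bilformDl Q u v w : bilform Q (u + v) w = bilform Q u w + bilform Q v w.
Proof. by rewrite /bilform linearD/= !mulmxDl mxE. Qed.

Lemma bilformDr Q u v w : bilform Q u (v + w) = bilform Q u v + bilform Q u w.
Proof. by rewrite /bilform mulmxDr mxE. Qed.

Lemma bilformZl Q k u v : bilform Q (k *: u) v = k * bilform Q u v.
Proof. by rewrite /bilform linearZ/= -!scalemxAl mxE. Qed.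

Lemma bilformZr Q k u v : bilform Q u (k *: v) = k * bilform Q u v.
Proof. by rewrite /bilform -!scalemxAr mxE. Qed.

Lemma bilformNl Q u v : bilform Q (- u) v = - bilform Q u v.
Proof. by rewrite -scaleN1r bilformZl mulN1r. Qed.

Lemma bilformNr Q u v : bilform Q u (- v) = - bilform Q u v.
Proof. by rewrite -scaleN1r bilformZr mulN1r. Qed.

Lemma bilformC Q u v : Q^T = Q -> bilform Q u v = bilform Q v u.
Proof.
move=> QT; rewrite /bilform.
have -> : v^T *m Q *m u = (u^T *m Q *m v)^T.
  by rewrite !trmx_mul trmxK QT mulmxA.
by rewrite [in RHS]mxE.
Qed.

Lemma bilform_mulr Q W u v : bilform (Q *m W) u v = bilform Q u (W *m v).
Proof. by rewrite /bilform !mulmxA. Qed.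

Lemma bilform_mull Q W u v : bilform (W *m Q) u v = bilform Q (W^T *m u) v.
Proof. by rewrite /bilform trmx_mul trmxK !mulmxA. Qed.

Lemma bilformE Q u v : bilform Q u v = \sum_i u i 0 * (Q *m v) i 0.
Proof. by rewrite /bilform -mulmxA mxE; apply: eq_bigr => i _; rewrite mxE. Qed.

Lemma bilform_suml Q (I : Type) (r : seq I) (F : I -> 'cV[R]_n) u :
  bilform Q (\sum_(i <- r) F i) u = \sum_(i <- r) bilform Q (F i) u.
Proof. by rewrite /bilform raddf_sum/= !mulmx_suml summxE. Qed.

Lemma sqnormE Q u : sqnorm Q u = bilform Q u u.
Proof. by []. Qed.

Lemma sqnorm1E u : sqnorm 1%:M u = \sum_i u i 0 ^+ 2.
Proof.
rewrite sqnormE bilformE.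
by apply: eq_bigr => i _; rewrite mul1mx expr2.
Qed.

Lemma sqnorm1_ge0 u : 0 <= sqnorm 1%:M u.
Proof. by rewrite sqnorm1E sumr_ge0// => i _; exact: sqr_ge0. Qed.

Lemma sqnorm_conv Q k u v : Q^T = Q ->
  sqnorm Q ((1 - k) *: u + k *: v) =
  (1 - k) * sqnorm Q u + k * sqnorm Q v - k * (1 - k) * sqnorm Q (u - v).
Proof.
move=> QT; rewrite !sqnormE.
rewrite !(bilformDl, bilformDr, bilformZl, bilformZr, bilformNl, bilformNr).
rewrite (bilformC v u QT); ring.
Qed.

End bilform.

Section projector.
Context {R : realType} {m n : nat}.
Variable A : 'M[R]_(m, n).
Local Notation Pi := (ker_proj A).
Implicit Types u v : 'cV[R]_n.

Lemma ker_proj_tr : Pi^T = Pi.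
Proof. by case: (pseudoinvP A). Qed.

Lemma ker_proj_idem : Pi *m Pi = Pi.
Proof. by rewrite /ker_proj mulmxA; case: (pseudoinvP A) => _ ->. Qed.

Lemma bilform_ker_proj u v : bilform Pi u v = bilform 1%:M (Pi *m u) (Pi *m v).
Proof.
by rewrite -{1}ker_proj_idem bilform_mulr -{1}[Pi]mulmx1 bilform_mull ker_proj_tr.
Qed.

Lemma sqnorm_ker_proj_ge0 u : 0 <= sqnorm Pi u.
Proof. by rewrite sqnormE bilform_ker_proj -sqnormE sqnorm1_ge0. Qed.

Lemma sqnorm_ker_proj_le u : sqnorm Pi u <= sqnorm 1%:M u.
Proof.
have E : sqnorm 1%:M (u - Pi *m u) = sqnorm 1%:M u - sqnorm Pi u.
  rewrite !sqnormE.
  rewrite !(bilformDl, bilformDr, bilformNl, bilformNr) -bilform_ker_proj.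
  rewrite -bilform_mulr (bilformC (Pi *m u)) ?trmx1// -bilform_mulr mul1mx; ring.
by have := sqnorm1_ge0 (u - Pi *m u); rewrite E subr_ge0.
Qed.

(** By symmetry and idempotence the diagonal entry is the squared length of row [i]; when it is 1
    the diagonal exhausts the row and all other entries vanish. *)
Lemma ker_proj_fix i u : Pi i i = 1 -> (Pi *m u) i 0 = u i 0.
Proof.
move=> Pii; have E : \sum_j Pi i j ^+ 2 = 1.
  rewrite -Pii -[in RHS]ker_proj_idem mxE; apply: eq_bigr => j _.
  have -> : Pi j i = Pi i j by rewrite -[in RHS]ker_proj_tr [RHS]mxE.
  by rewrite expr2.
have off j : j != i -> Pi i j = 0.
  move=> ji; apply/eqP; rewrite -sqrf_eq0; apply/eqP.
  have {}E : \sum_(k | k != i) Pi i k ^+ 2 = 0.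
    by move: E; rewrite (bigD1 i)//= Pii expr1n -[RHS]addr0 => /addrI.
  by apply: (psumr_eq0P _ E) => // k _; exact: sqr_ge0.
rewrite mxE (bigD1 i)//= Pii mul1r big1 ?addr0// => j ji.
by rewrite off ?mul0r.
Qed.

End projector.

Lemma pseudoinv_block_mx_of {R : realType} {d : nat} (p : {set 'I_d} -> R)
    (c : {set 'I_d}) : (forall i, 0 < coord_prob p i) ->
  pseudoinv (block_mx_of p c) =
  diag_mx (\row_i (if i \in c then (coord_prob p i)^-1 else 0)).
Proof.
move=> p_gt0; apply: (moore_penrose_uniq (pseudoinvP _)).
have p_neq0 i : coord_prob p i != 0 by rewrite gt_eqF.
rewrite /block_mx_of /moore_penrose !mulmx_diag !tr_diag_mx.
by split=> //; congr diag_mx; apply/rowP => i; rewrite !mxE;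
  case: ifP => _; rewrite ?mulr0// ?divff// ?mulVf// mul1r.
Qed.

Lemma bilform_continuous {R : realType} {n : nat} (W : 'M[R]_n) :
  continuous (fun u : 'rV[R]_n => bilform W u^T u^T).
Proof.
have -> : (fun u : 'rV[R]_n => bilform W u^T u^T) =
  (fun u => \sum_i \sum_j u 0 i * (W i j * u 0 j)).
  apply/funext => u; rewrite bilformE; apply: eq_bigr => i _.
  by rewrite !mxE mulr_sumr; apply: eq_bigr => j _; rewrite mxE.
apply: continuous_big => [|i _]; first exact: add_continuous.
apply: continuous_big => [|j _ u]; first exact: add_continuous.
have c k := @coord_continuous R 1 n 0 k u.
exact: (cvgM (c i) (cvgM (cvg_cst (W i j)) (c j))).
Qed.

(** The form is minimal at an isotropic [u], so its first-order variation in the direction [N *m u],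
    twice the squared norm of that vector, must vanish. *)
Lemma psd_isotropic {R : realType} {n : nat} (N : 'M[R]_n) (u : 'cV[R]_n) :
  N^T = N -> (forall z, 0 <= bilform N z z) -> bilform N u u = 0 -> N *m u = 0.
Proof.
move=> N_sym N_psd u0; set z := N *m u.
have zz : bilform N z u = sqnorm 1%:M z.
  by rewrite sqnormE -bilform_mulr mul1mx.
have key (s : R) : 0 <= s * (2 * sqnorm 1%:M z) + s ^+ 2 * bilform N z z.
  have := N_psd (u + s *: z).
  rewrite !(bilformDl, bilformDr, bilformZl, bilformZr) u0 (bilformC u z)// zz.
  by congr (_ <= _); ring.
have z0 : sqnorm 1%:M z = 0.
  apply/eqP; rewrite eq_le sqnorm1_ge0 andbT.
  move: key (N_psd z) (sqnorm1_ge0 z); move: (sqnorm _ _) (bilform _ _ _) => e f.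
  (* With s = e / (f + 1) the form at -s equals s^2 (- f - 2) < 0; adding 1 covers the case f =
     0. *)
  move=> /(_ (- (e / (f + 1)))) k f0 e0; rewrite leNgt; apply/negP => e1.
  have f1 : 0 < f + 1 by lra.
  move: k; set s := e / (f + 1) => k.
  have s_gt0 : 0 < s by rewrite divr_gt0.
  have es : e = s * (f + 1) by rewrite /s divfK// gt_eqF.
  have s2 : 0 < s ^+ 2 by rewrite exprn_gt0.
  have : 0 <= s ^+ 2 * (- f - 2) by move: k; rewrite es; congr (_ <= _); ring.
  by rewrite pmulr_rge0//; lra.
apply/colP => i; rewrite [RHS]mxE; apply/eqP; rewrite -sqrf_eq0; apply/eqP.
by move: z0; rewrite sqnorm1E => /psumr_eq0P -> // j _; exact: sqr_ge0.
Qed.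

(* The maximum of the Rayleigh quotient on the (compact) unit sphere is an
   eigenvalue, and it bounds all of them. *)
Lemma rayleigh_le {R : realType} {n : nat} (W : 'M[R]_n) (z : 'cV[R]_n) :
  W^T = W -> sqnorm W z <= lambda_max W * sqnorm 1%:M z.
Proof.
move=> W_sym.
have [->|z_neq0] := eqVneq z 0.
  by rewrite -(scale0r 0) !sqnormE !bilformZl !mul0r mulr0.
pose nrm (u : 'rV[R]_n) := bilform 1%:M u^T u^T.
have nrmE u : nrm u = \sum_i u 0 i ^+ 2.
  by rewrite /nrm -sqnormE sqnorm1E; apply: eq_bigr => i _; rewrite mxE.
have nrm_gt0 w : w != 0 -> 0 < nrm w.
  move=> w_neq0; rewrite lt_def nrmE sumr_ge0 ?andbT => [|i _]; last exact: sqr_ge0.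
  apply: contra w_neq0 => /eqP nw0; apply/eqP/rowP => i; rewrite mxE.
  apply/eqP; rewrite -sqrf_eq0; apply/eqP.
  by apply: (psumr_eq0P _ nw0) => // j _; exact: sqr_ge0.
pose K := [set u : 'rV[R]_n | nrm u = 1].
pose unit w := (Num.sqrt (nrm w))^-1 *: w.
have unitK w : w != 0 -> K (unit w).
  move=> /nrm_gt0 nw; rewrite /K/= /nrm linearZ/= bilformZl bilformZr -/(nrm w).
  by rewrite mulrA -expr2 exprVn sqr_sqrtr ?ltW// mulVf// gt_eqF.
have zT_neq0 : z^T != 0 by rewrite trmx_eq0.
have K_neq0 : K !=set0 by exists (unit z^T); exact: unitK.
have K_compact : compact K.
  apply: bounded_closed_compact.
    exists 1; split=> // r r1 u /= Ku; rewrite [`|u|]mx_normrE.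
    apply: bigmax_le => [|[i j] _ /=]; first by rewrite ltW// (lt_trans _ r1).
    rewrite (ord1 i); apply: le_trans (ltW r1).
    rewrite -(@expr_le1 _ 2)// real_normK ?num_real// -Ku nrmE (bigD1 j)//=.
    by rewrite lerDl sumr_ge0// => k _; exact: sqr_ge0.
  have -> : K = nrm @^-1` [set x | x = 1] by [].
  by apply: preimage_closed; [move=> u _; exact: bilform_continuous|exact: closed_eq].
have [u /[!inE] Ku umax] := compact_EVT_max K_neq0 K_compact
  (continuous_subspaceT (@bilform_continuous _ _ W)).
set mu := bilform W u^T u^T in umax.
have le_mu w : bilform W w^T w^T <= mu * nrm w.
  have [->|w_neq0] := eqVneq w 0.
    by rewrite /nrm trmx0 -(scale0r 0) !bilformZl !mul0r mulr0.
  have nw := nrm_gt0 _ w_neq0.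
  have := umax (unit w); rewrite inE => /(_ (unitK _ w_neq0)).
  rewrite /unit linearZ/= bilformZl bilformZr mulrA -expr2 exprVn.
  by rewrite sqr_sqrtr ?(ltW nw)// ler_pdivrMl// [nrm w * _]mulrC.
(* Maximality makes [mu%:M - W] positive semidefinite with [u^T] isotropic, hence in its kernel. *)
have mu_eig : eigenvalue W mu.
  have NE (w : 'cV[R]_n) :
      bilform (mu%:M - W) w w = mu * bilform 1%:M w w - bilform W w w.
    rewrite -[mu%:M]scalemx1 /bilform mulmxBr mulmxBl -scalemxAr -scalemxAl.
    by rewrite [LHS]mxE [X in X + _ = _]mxE [X in _ + X = _]mxE.
  have N_psd (w : 'cV[R]_n) : 0 <= bilform (mu%:M - W) w w.
    rewrite NE.
    by rewrite subr_ge0; have := le_mu w^T; rewrite /nrm trmxK.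
  have := @psd_isotropic _ _ (mu%:M - W) u^T.
  rewrite linearB/= tr_scalar_mx W_sym => /(_ erefl N_psd).
  move=> N0; apply/eigenvalueP; exists u.
    apply: trmx_inj; rewrite trmx_mul W_sym linearZ/=; apply/esym/eqP.
    rewrite -subr_eq0 -mul_scalar_mx -mulmxBl N0//.
    have -> : bilform (mu%:M - W) u^T u^T = mu * nrm u - mu.
      by rewrite NE.
    by rewrite Ku mulr1 subrr.
  apply/eqP => u0; move: Ku; rewrite /K/= u0 /nrm trmx0 -(scale0r 0) bilformZl mul0r.
  by move/eqP; rewrite eq_sym oner_eq0.
have mu_le : mu <= lambda_max W.
  apply: ub_le_sup => //; exists mu => e /= /eigenvalueP[w wW w0].
  have nw : nrm w = (w *m w^T) 0 0 by rewrite /nrm /bilform trmxK mulmx1.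
  have -> : e = bilform W w^T w^T / nrm w.
    rewrite nw /bilform trmxK wW -scalemxAl [X in X / _]mxE mulfK// -nw.
    by rewrite gt_eqF// nrm_gt0.
  by rewrite ler_pdivrMr// nrm_gt0.
have := le_mu z^T; rewrite /nrm trmxK => /le_trans; apply.
by rewrite ler_wpM2r// sqnorm1_ge0.
Qed.

(** * Gradients and proximal points *)

Lemma derivative_const_line {R : realType} {d : nat} (q : 'cV[R]_d -> R)
    (w u : 'cV[R]_d) :
  (forall h, q (h *: u + w) = q w) -> 'D_u (q : 'cV[R]_d -> R^o) w = 0.
Proof.
move=> qc; rewrite /derive.
have -> : (fun h => h^-1 *: ((q \o shift w) (h *: u) - q w)) =
    cst 0 :> (R -> R^o).
  by apply/funext => h /=; rewrite qc subrr scaler0.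
exact: lim_cst.
Qed.

Lemma gradient_dot {R : realType} {d : nat} (q : 'cV[R]_d -> R) (w u : 'cV[R]_d) :
  differentiable (q : 'cV[R]_d -> R^o) w ->
  'D_u (q : 'cV[R]_d -> R^o) w = ((gradient q w)^T *m u) 0 0.
Proof.
move=> dq; rewrite deriveE// {1}[u]matrix_sum_delta linear_sum mxE.
apply: eq_bigr => i _; rewrite big_ord_recl big_ord0 addr0 linearZ/=.
by rewrite -deriveE// !mxE mulrC.
Qed.

(* The lower bound, used in both directions, shows that [q] is constant along
   the kernel of [A]. *)
Lemma gradient_ker_proj {R : realType} {m d : nat} (A : 'M[R]_(m, d))
    (q : 'cV[R]_d -> R) (sigma : R) (w : 'cV[R]_d) :
  (forall z, differentiable (q : 'cV[R]_d -> R^o) z) ->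
  (forall z w,
    q z - q w >= ((gradient q w)^T *m ker_proj A *m (z - w)) 0 0
                 + sigma / 2 * sqnorm (ker_proj A) (z - w)) ->
  ker_proj A *m gradient q w = gradient q w.
Proof.
move=> q_diff q_lower.
set Pi := ker_proj A in q_lower *; set G := gradient q w.
pose u := G - Pi *m G.
have Pu : Pi *m u = 0.
  by rewrite /u mulmxBr mulmxA ker_proj_idem subrr.
have qle z h : q z <= q (h *: u + z).
  have := q_lower (h *: u + z) z; rewrite addrK -mulmxA -scalemxAr Pu.
  rewrite scaler0 mulmx0 sqnormE bilformZl bilformZr.
  rewrite [bilform _ u u]bilformE Pu big1 => [|i _];
    last by rewrite [X in _ * X]mxE mulr0.
  by rewrite mxE !mulr0 addr0 subr_ge0.
have qc h : q (h *: u + w) = q w.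
  apply/eqP; rewrite eq_le qle andbT.
  by have := qle (h *: u + w) (- h); rewrite addrA scaleNr addNr add0r.
have := gradient_dot u (q_diff w); rewrite derivative_const_line// => uG.
have : sqnorm 1%:M u = 0.
  have -> : sqnorm 1%:M u = bilform 1%:M G u - bilform 1%:M (Pi *m G) u.
    by rewrite -bilformNl -bilformDl.
  have -> : bilform 1%:M (Pi *m G) u = bilform Pi G u.
    by rewrite -[in RHS](mulmx1 Pi) bilform_mull ker_proj_tr.
  by rewrite /bilform mulmx1 -uG -mulmxA Pu mulmx0 mxE subrr.
rewrite sqnorm1E => /psumr_eq0P u0; apply/esym/eqP; rewrite -subr_eq0 -/u.
apply/eqP/colP => i; rewrite [RHS]mxE; apply/eqP; rewrite -sqrf_eq0; apply/eqP.
by apply: u0 => // j _; exact: sqr_ge0.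
Qed.

Lemma convex_functionE {R : realType} (f : R -> R) (k x y : R) :
  convex_function (E := R^o) setT f -> 0 <= k <= 1 ->
  f ((1 - k) * x + k * y) <= (1 - k) * f x + k * f y.
Proof.
move=> cf k01; have := cf (Itv01 (andP k01).1 (andP k01).2) y x (in_setT _) (in_setT _).
by rewrite !convRE/= [X in f X]addrC [X in _ <= X]addrC.
Qed.

(** Minimality is tested at points of the segment from [v] to [u]: the first-order gain [s * D]
    cannot exceed the second-order cost [s ^+ 2 * C]. *)
Lemma prox_subgradient {R : realType} (eta : R) (f : R -> R) (x v u : R) :
  convex_function (E := R^o) setT f -> 0 < eta -> is_prox eta f x v ->
  (x - v) / eta * (u - v) <= f u - f v.
Proof.
move=> cf eta_gt0 pv; rewrite leNgt; apply/negP => lt.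
pose D := (x - v) / eta * (u - v) - (f u - f v).
have D_gt0 : 0 < D by rewrite subr_gt0.
pose C := (2 * eta)^-1 * (u - v) ^+ 2.
have C_ge0 : 0 <= C by rewrite mulr_ge0 ?sqr_ge0// invr_ge0; lra.
have key s : 0 <= s <= 1 -> s * D <= s ^+ 2 * C.
  move=> s01; have := pv ((1 - s) * v + s * u).
  have := convex_functionE v u cf s01.
  have -> : (2 * eta)^-1 * ((1 - s) * v + s * u - x) ^+ 2 =
      (2 * eta)^-1 * (v - x) ^+ 2 - s * ((x - v) / eta * (u - v)) + s ^+ 2 * C.
    by rewrite /C; field; rewrite gt_eqF.
  rewrite /D; lra.
(* Any s in ]0, 1] with s C < D contradicts [key]; this one works even when C = 0. *)
pose s := D / (C + D).
have CD : 0 < C + D by lra.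
have s_gt0 : 0 < s by rewrite divr_gt0.
have s_le1 : s <= 1 by rewrite ler_pdivrMr// mul1r; lra.
have sC : s * (C + D) = D by rewrite divfK// gt_eqF.
have := key s; rewrite s_le1 ltW// => /(_ isT).
by rewrite expr2 -mulrA ler_pM2l//; nra.
Qed.

Lemma prox_uniq {R : realType} (eta : R) (f : R -> R) (x v w : R) :
  convex_function (E := R^o) setT f -> 0 < eta ->
  is_prox eta f x v -> is_prox eta f x w -> v = w.
Proof.
move=> cf eta_gt0 pv pw.
have h1 := prox_subgradient w cf eta_gt0 pv.
have h2 := prox_subgradient v cf eta_gt0 pw.
have h : (v - w) ^+ 2 / eta <= 0.
  have -> : (v - w) ^+ 2 / eta =
    (x - v) / eta * (w - v) + (x - w) / eta * (v - w).
    by field; rewrite gt_eqF.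
  lra.
apply/eqP; rewrite -subr_eq0 -sqrf_eq0 eq_le sqr_ge0 andbT.
by move: h; rewrite ler_pdivrMr// mul0r.
Qed.

(** * The coefficient sequences *)

Section coefficients.
Context {R : realType} (sigma S : R) (a As Bs alpha beta eta : nat -> R).
Hypothesis coefs : apcg_coefficients sigma S a As Bs alpha beta eta.
Hypothesis sigma_ge0 : 0 <= sigma.
Hypothesis B0_ge0 : 0 <= Bs 0%N.

Let a_gt0 t : 0 < a t.+1 := coef_a_gt0 coefs t.

Lemma coef_B_ge0 t : 0 <= Bs t.
Proof.
elim: t => // t IH; rewrite (coef_B coefs) addr_ge0// mulr_ge0// ltW//.
Qed.

Lemma coef_B_gt0 t : 0 < Bs t.+1.
Proof. by rewrite lt_def coef_B_ge0 (coef_B_neq0 coefs). Qed.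

(** No sign is known for [As 0]; positivity comes from the product [As t.+1 * Bs t.+1] being a
    square. *)
Lemma coef_A_gt0 t : 0 < As t.+1.
Proof.
rewrite lt_def (coef_A_neq0 coefs)/= -(pmulr_lge0 _ (coef_B_gt0 t)).
by rewrite -(coef_a_eq coefs) mulr_ge0// sqr_ge0.
Qed.

Lemma coef_S2_gt0 : 0 < S ^+ 2.
Proof.
have := mulr_gt0 (coef_A_gt0 0) (coef_B_gt0 0).
by rewrite -(coef_a_eq coefs) pmulr_rgt0// exprn_gt0.
Qed.

Let S2_neq0 : S ^+ 2 != 0. Proof. by rewrite gt_eqF// coef_S2_gt0. Qed.

Lemma coef_alpha_gt0 t : 0 < alpha t.
Proof. by rewrite (coef_alpha coefs) divr_gt0// coef_A_gt0. Qed.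

Lemma coef_eta_gt0 t : 0 < eta t.
Proof. by rewrite (coef_eta coefs) divr_gt0// coef_B_gt0. Qed.

Lemma coef_beta_ge0 t : 0 <= beta t.
Proof.
by rewrite (coef_beta coefs) divr_ge0// ?mulr_ge0// ltW// coef_B_gt0.
Qed.

Lemma coef_beta_compl t : Bs t.+1 * (1 - beta t) = Bs t.
Proof.
rewrite (coef_beta coefs) mulrBr mulr1 mulrC divfK ?(coef_B_neq0 coefs)//.
by rewrite (coef_B coefs) addrK.
Qed.

Lemma coef_beta_le1 t : beta t <= 1.
Proof.
by rewrite -subr_ge0 -(pmulr_rge0 _ (coef_B_gt0 t)) coef_beta_compl coef_B_ge0.
Qed.

Lemma coef_alphaM t : As t.+1 * alpha t = a t.+1.
Proof. by rewrite (coef_alpha coefs) mulrC divfK// (coef_A_neq0 coefs). Qed.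

Lemma coef_betaM t : Bs t.+1 * beta t = sigma * a t.+1.
Proof. by rewrite (coef_beta coefs) mulrC divfK// (coef_B_neq0 coefs). Qed.

Lemma coef_etaM t : Bs t.+1 * eta t = a t.+1.
Proof. by rewrite (coef_eta coefs) mulrC divfK// (coef_B_neq0 coefs). Qed.

Lemma coef_alpha_compl t : As t.+1 * (1 - alpha t) = As t.
Proof. by rewrite mulrBr mulr1 coef_alphaM (coef_A coefs) addrK. Qed.

Lemma coef_alpha_lt1 t : alpha t.+1 < 1.
Proof.
rewrite -subr_gt0 -(pmulr_rgt0 _ (coef_A_gt0 t.+1)) coef_alpha_compl.
exact: coef_A_gt0.
Qed.

Lemma coef_alpha_eta t : alpha t * eta t * S ^+ 2 = 1.
Proof.
have A0 := coef_A_neq0 coefs t; have B0 := coef_B_neq0 coefs t.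
rewrite (coef_alpha coefs) (coef_eta coefs) mulf_div -expr2 mulrAC.
by rewrite (coef_a_eq coefs) divff// mulf_neq0.
Qed.

(** The product is constant in time, so a bound obtained in the limit of large [t] is valid at every
    step. *)
Lemma coef_alpha_beta t : alpha t * beta t = sigma / S ^+ 2.
Proof.
have -> : beta t = sigma * eta t.
  by rewrite (coef_beta coefs) (coef_eta coefs) mulrA.
by apply: (mulIf S2_neq0); rewrite divfK// [alpha t * _]mulrCA
  -mulrA coef_alpha_eta mulr1.
Qed.

Lemma coef_alpha_sqr t : As t.+1 * (alpha t ^+ 2 * S ^+ 2) = Bs t.+1.
Proof.
apply: (mulfI (coef_A_neq0 coefs t)); rewrite -(coef_a_eq coefs) -coef_alphaM.
ring.
Qed.

(** After multiplication by [As t.+2 * S ^+ 2] both sides become [Bs t.+1], once through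
    [coef_alpha_compl] and once through [coef_beta_compl]. *)
Lemma coef_alpha_rec t :
  alpha t ^+ 2 * (1 - alpha t.+1) = alpha t.+1 ^+ 2 * (1 - beta t.+1).
Proof.
apply: (mulIf S2_neq0); apply: (mulfI (coef_A_neq0 coefs t.+1)).
transitivity (Bs t.+1).
  by rewrite -coef_alpha_sqr -(coef_alpha_compl t.+1); ring.
by rewrite -coef_beta_compl -coef_alpha_sqr; ring.
Qed.

(** From index 1 on, [As] and [Bs] are positive and nondecreasing, hence so is their product. This
    gives [As] at least linear growth. *)
Lemma coef_a_ge t : a 1%N <= a t.+1.
Proof.
have nd_A s : As 1%N <= As s.+1.
  elim: s => // s /le_trans; apply; rewrite [leRHS](coef_A coefs) lerDl ltW//.
have nd_B s : Bs 1%N <= Bs s.+1.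
  elim: s => // s /le_trans; apply.
  by rewrite [leRHS](coef_B coefs) lerDl mulr_ge0// ltW.
rewrite -(@ler_pXn2r _ 2)// ?nnegrE ?(ltW (a_gt0 _))// -(ler_pM2r coef_S2_gt0).
by rewrite !(coef_a_eq coefs) ler_pM// ltW// ?coef_A_gt0 ?coef_B_gt0.
Qed.

Lemma coef_A_ge t : As 0%N + t%:R * a 1%N <= As t.
Proof.
elim: t => [|t IH]; first by rewrite mul0r addr0.
by rewrite (coef_A coefs) -natr1 mulrDl mul1r addrA lerD// coef_a_ge.
Qed.

Lemma coef_B_eq t : Bs t = Bs 0%N + sigma * (As t - As 0%N).
Proof.
elim: t => [|t IH]; first by rewrite subrr mulr0 addr0.
by rewrite (coef_B coefs) IH (coef_A coefs); ring.
Qed.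

(* [alpha t ^+ 2 * S ^+ 2 = Bs t.+1 / As t.+1] tends to [sigma] since [As] is
   unbounded, so the upper bound [r] on [alpha] also bounds the limit. *)
Lemma coef_kappa_le (r : R) : 0 < r -> (forall t, alpha t <= r) ->
  sigma / S ^+ 2 <= r ^+ 2.
Proof.
move=> r_gt0 alpha_le; rewrite ler_pdivrMr ?coef_S2_gt0// leNgt; apply/negP => lt.
pose e := sigma - r ^+ 2 * S ^+ 2.
have e_gt0 : 0 < e by rewrite subr_gt0.
have ub t : e * As t.+1 <= sigma * As 0%N - Bs 0%N.
  have : As t.+1 * (alpha t ^+ 2 * S ^+ 2) <= As t.+1 * (r ^+ 2 * S ^+ 2).
    rewrite ler_pM2l ?coef_A_gt0// ler_pM2r ?coef_S2_gt0//.
    by rewrite ler_pXn2r// nnegrE ltW// coef_alpha_gt0.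
  rewrite coef_alpha_sqr coef_B_eq /e; nra.
have a1 := a_gt0 0.
(* Beyond [k] steps the linear lower bound on [As] exceeds the upper bound [ub]. *)
pose k := ((sigma * As 0%N - Bs 0%N) / e - As 0%N) / a 1%N.
have [n nk] : exists n : nat, k < n%:R.
  by exists (Num.truncn `|k|).+1; rewrite (le_lt_trans (ler_norm _))// truncnS_gt.
have := ub n; rewrite mulrC -ler_pdivlMr// => /(le_trans (coef_A_ge n.+1)).
rewrite -lerBrDl -ler_pdivlMr// -/k => /le_lt_trans/(_ nk).
by rewrite ltr_nat ltnNge leqnSn.
Qed.

Section weights.
Variable r : R.
Hypotheses (r_gt0 : 0 < r) (r_le1 : r <= 1).
Hypothesis step : forall t, 0 <= 1 - beta t - alpha t / r.

Lemma step_alpha_le t : alpha t <= r * (1 - beta t).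
Proof. by rewrite mulrC -ler_pdivrMr//; have := step t; lra. Qed.

Lemma step_alpha_le_prob t : alpha t <= r.
Proof.
apply: le_trans (step_alpha_le t) _; rewrite ler_piMr// ?(ltW r_gt0)//.
by have := coef_beta_ge0 t; lra.
Qed.

(* Weight of [v t] in the expansion of [x t]. *)
Definition prox_weight (t : nat) : R := if t is s.+1 then alpha s / r else 1.

Lemma prox_weight_itv t : 0 <= prox_weight t <= 1.
Proof.
case: t => [|t] /=; first by rewrite ler01 lexx.
rewrite divr_ge0 ?(ltW r_gt0) ?(ltW (coef_alpha_gt0 t))//=.
by have := step t; have := coef_beta_ge0 t; lra.
Qed.

Lemma step_kappa_le t : alpha t * beta t / r <= beta t * (1 - beta t).
Proof.
by rewrite ler_pdivrMr//; have := step_alpha_le t; have := coef_beta_ge0 t; nra.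
Qed.

(* Nonnegativity of the weight that [v_t] retains in [x_{t+1}]. *)
Lemma prox_weight_step t :
  0 <= (1 - alpha t * beta t / r) * (1 - alpha t) * prox_weight t
       + (1 - beta t) * alpha t * (1 - r^-1).
Proof.
have r1 : 0 <= 1 - r by rewrite subr_ge0.
have al := step_alpha_le t; have ar := step_alpha_le_prob t.
have b0 := coef_beta_ge0 t; have b1 := coef_beta_le1 t.
have k1 := step_kappa_le t; have a0 := coef_alpha_gt0 t.
rewrite -(pmulr_rge0 _ r_gt0); set k := alpha t * beta t / r in k1 *.
have -> : r * ((1 - k) * (1 - alpha t) * prox_weight t
               + (1 - beta t) * alpha t * (1 - r^-1)) =
    (1 - k) * (1 - alpha t) * (r * prox_weight t)
    - (1 - beta t) * alpha t * (1 - r).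
  by rewrite [r^-1](_ : _ = 1 / r) ?div1r//; field; rewrite gt_eqF.
have k2 : 1 - beta t <= 1 - k by nra.
have k0 : 0 <= 1 - k by lra.
rewrite subr_ge0.
(* At time 0 the weight is 1, and [alpha <= r] with [1 - beta <= 1 - k] suffices. Afterwards
   [r * prox_weight] is the previous [alpha]. *)
case: t => [|t] /= in k al ar b0 b1 k1 a0 k2 k0 *.
  have c0 : 0 <= alpha 0%N * (1 - r) by rewrite mulr_ge0 ?subr_ge0// ltW.
  by rewrite mulr1 -!mulrA ler_pM//; lra.
rewrite [r * _]mulrC divfK ?gt_eqF//.
have a0' := coef_alpha_gt0 t; have rec := coef_alpha_rec t.
(* After multiplication by [alpha t], the recursion for [alpha] brings out the common factor
   [(1 - beta t.+1) * alpha t.+1]. *)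
suff G : (1 - r) * alpha t <= (1 - k) * alpha t.+1.
  rewrite -(ler_pM2r a0').
  have -> : (1 - k) * (1 - alpha t.+1) * alpha t * alpha t =
      ((1 - k) * alpha t.+1) * ((1 - beta t.+1) * alpha t.+1).
    rewrite -!mulrA -expr2; congr (_ * _).
    by rewrite [LHS]mulrC rec; ring.
  rewrite [leLHS](_ : _ = ((1 - r) * alpha t) * ((1 - beta t.+1) * alpha t.+1));
    last by ring.
  by rewrite ler_wpM2r// mulr_ge0//; lra.
(* If [alpha] does not decrease, [k <= r] is enough, and it reads [sigma / S ^+ 2 <= r ^+ 2]. *)
have [le_a|lt_a] := leP (alpha t) (alpha t.+1).
  have kr : k <= r.
    rewrite /k coef_alpha_beta ler_pdivrMr// -expr2.
    exact: coef_kappa_le step_alpha_le_prob.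
  by rewrite ler_pM//; lra.
(* If [alpha] decreases, the recursion forces [beta <= alpha <= r] at the new index. Both [1 - beta]
   and [1 - alpha] then dominate [1 - r], and the claim follows after squaring. *)
have ba : beta t.+1 <= alpha t.+1.
  rewrite leNgt; apply/negP => lt_ab.
  have : alpha t.+1 ^+ 2 * (1 - beta t.+1) < alpha t ^+ 2 * (1 - alpha t.+1).
    apply: ltr_pM; [exact: sqr_ge0|lra|by rewrite ltr_pXn2r ?nnegrE ?(ltW a0) ?(ltW a0')|lra].
  by rewrite rec ltxx.
apply: le_trans (_ : (1 - beta t.+1) * alpha t.+1 <= _); last by rewrite ler_pM2r.
rewrite -(@ler_pXn2r _ 2) ?nnegrE ?mulr_ge0 ?subr_ge0 ?(ltW a0) ?(ltW a0')//.
have -> : ((1 - beta t.+1) * alpha t.+1) ^+ 2 =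
    (1 - beta t.+1) * (1 - alpha t.+1) * alpha t ^+ 2.
  by rewrite -mulrA [(1 - alpha _) * _]mulrC rec; ring.
rewrite exprMn ler_wpM2r ?sqr_ge0// expr2 ler_pM//; lra.
Qed.

End weights.
End coefficients.

(** * Averages of a convex function along one coordinate *)

(* [h] majorizes [f x] through a representation of [x] as an average which gives
   weight [w] to the point [v]. *)
Definition averages {R : realType} (f : R -> R) (w v x h : R) : Prop :=
  exists u g, [/\ f u <= g, x = (1 - w) * u + w * v & h = (1 - w) * g + w * f v].

Section averages.
Context {R : realType} (f : R -> R).
Hypothesis f_convex : convex_function (E := R^o) setT f.
Variables (alpha beta r w v x h : R).
Hypotheses (alpha_gt0 : 0 < alpha) (beta01 : 0 <= beta <= 1).
Hypotheses (r_gt0 : 0 < r) (r_le1 : r <= 1).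
Hypothesis step : alpha <= r * (1 - beta).
Hypothesis w01 : 0 <= w <= 1.
Hypothesis weight : 0 <= (1 - alpha * beta / r) * (1 - alpha) * w
                         + (1 - beta) * alpha * (1 - r^-1).
Hypothesis avg : averages f w v x h.

(** [yh] and [wh] are the surrogate values at [y] and [w]: the same affine combinations as the
    points, with [h] in place of [x] and [f v] in place of [v]. *)
Let lam := (1 - alpha) / (1 - alpha * beta).
Let y := lam * x + (1 - lam) * v.
Let yh := lam * h + (1 - lam) * f v.
Let wh := (1 - beta) * f v + beta * yh.

Lemma averages_le : f x <= h.
Proof.
case: avg => u [g [fu -> ->]]; apply: le_trans (convex_functionE u v f_convex w01) _.
by rewrite lerD2r ler_wpM2l// subr_ge0; case/andP: w01.
Qed.

Let alpha_le1 : alpha <= 1.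
Proof.
have := step; have := r_gt0; have := r_le1; case/andP: beta01; nra.
Qed.

Let kappa_lt1 : 0 < 1 - alpha * beta.
Proof.
have := step; have := r_gt0; have := r_le1; have := alpha_gt0.
case/andP: beta01; nra.
Qed.

Let lam01 : 0 <= lam <= 1.
Proof.
rewrite /lam divr_ge0 ?(ltW kappa_lt1) ?subr_ge0 ?alpha_le1//= ler_pdivrMr// mul1r.
by rewrite lerD2l lerN2 ler_piMr// ?(ltW alpha_gt0)//; case/andP: beta01.
Qed.

Lemma averages_step (v' : R) :
  averages f (alpha / r) v' (y + alpha / r * (v' - (1 - beta) * v - beta * y))
    (yh + alpha / r * (f v' - wh)).
Proof.
case: avg => u [g [fu xE hE]].
(* [e1] and [e2] are the coefficients of [u] and [v] when the new point is expanded over [u], [v]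
   and [v']; up to a positive factor, [e2] is the quantity in the hypothesis [weight]. *)
pose e1 := (1 - alpha * beta / r) * lam * (1 - w).
pose e2 := (1 - alpha * beta / r) * lam * w
           + ((1 - alpha * beta / r) * (1 - lam) - alpha / r * (1 - beta)).
have r_neq0 : r != 0 by rewrite gt_eqF.
have k_neq0 : 1 - alpha * beta != 0 by rewrite gt_eqF.
have e12 : e1 + e2 = 1 - alpha / r by rewrite /e1 /e2; field.
have e1_ge0 : 0 <= e1.
  apply: mulr_ge0; last by rewrite subr_ge0; case/andP: w01.
  apply: mulr_ge0; last by case/andP: lam01.
  rewrite subr_ge0 ler_pdivrMr// mul1r.
  by have := step; have := r_gt0; have := alpha_gt0; case/andP: beta01; nra.
have e2_ge0 : 0 <= e2.
  have -> : e2 = ((1 - alpha * beta / r) * (1 - alpha) * w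
                  + (1 - beta) * alpha * (1 - r^-1)) / (1 - alpha * beta).
    by rewrite /e2 /lam; field; rewrite k_neq0.
  by rewrite divr_ge0// ltW.
(* When all the weight lies on [v'], the remaining point is arbitrary and [e1], [e2] cannot be
   normalized. *)
have [s0|s_neq0] := eqVneq (1 - alpha / r) 0.
  have e1_0 : e1 = 0 by lra.
  have e2_0 : e2 = 0 by lra.
  exists v', (f v'); split=> //; rewrite s0 mul0r add0r.
    transitivity (e1 * u + e2 * v + alpha / r * v'); first by rewrite /e1 /e2 /y xE; ring.
    by rewrite e1_0 e2_0; lra.
  transitivity (e1 * g + e2 * f v + alpha / r * f v').
    by rewrite /e1 /e2 /wh /yh hE; ring.
  by rewrite e1_0 e2_0; lra.
have s_gt0 : 0 < e1 + e2 by rewrite lt_def addr_ge0// e12 s_neq0.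
pose k := e2 / (e1 + e2).
have k01 : 0 <= k <= 1.
  by rewrite divr_ge0 ?(ltW s_gt0)//= ler_pdivrMr// mul1r lerDr.
have kE : (1 - alpha / r) * k = e2 by rewrite -e12 mulrC divfK// gt_eqF.
have kE1 : (1 - alpha / r) * (1 - k) = e1 by rewrite mulrBr mulr1 kE -e12 addrK.
exists ((1 - k) * u + k * v), ((1 - k) * g + k * f v); split.
- apply: le_trans (convex_functionE u v f_convex k01) _.
  by rewrite lerD2r ler_wpM2l// subr_ge0; case/andP: k01.
- transitivity (e1 * u + e2 * v + alpha / r * v').
    by rewrite /e1 /e2 /y xE; ring.
  by rewrite -kE1 -kE; ring.
- transitivity (e1 * g + e2 * f v + alpha / r * f v').
    by rewrite /e1 /e2 /wh /yh hE; ring.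
  by rewrite -kE1 -kE; ring.
Qed.

(* Averaged over a coordinate drawn with probability [r], the step costs
   [alpha] times the new value and keeps [1 - alpha] of the old one. *)
Lemma averages_mean (v' : R) :
  r * (yh + alpha / r * (f v' - wh))
  + (1 - r) * (yh + alpha / r * (f ((1 - beta) * v + beta * y) - wh))
  <= (1 - alpha) * h + alpha * f v'.
Proof.
have r_neq0 : r != 0 by rewrite gt_eqF.
have k_neq0 : 1 - alpha * beta != 0 by rewrite gt_eqF.
have yE : yh = (1 - alpha) * h + alpha * wh.
  by rewrite /wh /yh /lam; field.
have le_w : f ((1 - beta) * v + beta * y) <= wh.
  apply: le_trans (convex_functionE v y f_convex beta01) _.
  rewrite lerD2l ler_wpM2l//; first by case/andP: beta01.
  rewrite /y addrC -[X in _ + X * x](subKr 1 lam).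
  have lam01' : 0 <= 1 - lam <= 1 by case/andP: lam01 => ? ?; lra.
  rewrite addrC; apply: le_trans (convex_functionE x v f_convex lam01') _.
  rewrite subKr /yh lerD2r ler_wpM2l//; first by case/andP: lam01.
  exact: averages_le.
have -> : r * (yh + alpha / r * (f v' - wh))
  + (1 - r) * (yh + alpha / r * (f ((1 - beta) * v + beta * y) - wh)) =
  yh - alpha * wh + alpha * f v'
  + (1 - r) * (alpha / r) * (f ((1 - beta) * v + beta * y) - wh) by field.
rewrite yE addrK gerDl; apply: mulr_ge0_le0; last by rewrite subr_le0.
by rewrite mulr_ge0 ?subr_ge0// divr_ge0// ltW.
Qed.

End averages.

(** * One step of the algorithm, averaged over the block *)

Section block_step.
Context {R : realType} {m d : nat} (A : 'M[R]_(m, d)) (q : 'cV[R]_d -> R).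
Context (psi : 'I_d -> R -> R) (sigma S : R) (M : 'M[R]_d) (p : {set 'I_d} -> R).
Context (a As Bs alpha beta eta : nat -> R).
Local Notation Pi := (ker_proj A).
Local Notation Pinv c := (pseudoinv (block_mx_of p c)).
Hypothesis q_diff : forall z, differentiable (q : 'cV[R]_d -> R^o) z.
Hypothesis sigma_ge0 : 0 <= sigma.
Hypothesis q_lower : forall z w,
  q z - q w >= ((gradient q w)^T *m Pi *m (z - w)) 0 0
               + sigma / 2 * sqnorm Pi (z - w).
Hypothesis M_sym : M^T = M.
Hypothesis q_upper : forall z w,
  q z - q w <= ((gradient q w)^T *m Pi *m (z - w)) 0 0
               + 1 / 2 * sqnorm M (z - w).
Hypothesis p_ge0 : forall c, 0 <= p c.
Hypothesis p_sum : \sum_c p c = 1.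
Hypothesis p_gt0 : forall i, 0 < coord_prob p i.
Hypothesis S_ge : forall c : {set 'I_d}, 0 < p c ->
  S ^+ 2 >= lambda_max (Pi *m Pinv c *m M *m Pinv c *m Pi).
Hypothesis coefs : apcg_coefficients sigma S a As Bs alpha beta eta.
Hypothesis B0_ge0 : 0 <= Bs 0%N.

Lemma Pinv_tr c : (Pinv c)^T = Pinv c.
Proof. by rewrite pseudoinv_block_mx_of// tr_diag_mx. Qed.

Lemma PinvE c (g : 'cV[R]_d) i :
  (Pinv c *m g) i 0 = if i \in c then g i 0 / coord_prob p i else 0.
Proof.
rewrite pseudoinv_block_mx_of// mul_diag_mx !mxE.
by case: ifP => _; [rewrite mulrC|rewrite mul0r].
Qed.

Lemma coord_prob_le1 i : coord_prob p i <= 1.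
Proof.
rewrite -p_sum /coord_prob [leRHS](bigID (fun c : {set 'I_d} => i \in c))/=.
by rewrite lerDl sumr_ge0.
Qed.

Lemma mean_coord i (u w : R) :
  \sum_c p c * (if i \in c then u else w) =
  coord_prob p i * u + (1 - coord_prob p i) * w.
Proof.
rewrite -p_sum [in RHS](bigID (fun c : {set 'I_d} => i \in c))/=.
rewrite -/(coord_prob p i) [X in X - _]addrC addrK.
rewrite (bigID (fun c : {set 'I_d} => i \in c))/= /coord_prob !mulr_suml.
by congr (_ + _); apply: eq_bigr => c; [move=> ->|move=> /negbTE ->].
Qed.

Lemma mean_Pinv (g : 'cV[R]_d) : \sum_c p c *: (Pinv c *m g) = g.
Proof.
apply/colP => i; rewrite summxE.
rewrite (eq_bigr (fun c : {set 'I_d} =>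
    p c * (if i \in c then g i 0 / coord_prob p i else 0))); last first.
  by move=> c _; rewrite mxE PinvE.
by rewrite mean_coord mulr0 addr0 mulrC divfK// gt_eqF.
Qed.

Section step.
Variable t : nat.
Local Notation al := (alpha t).
Local Notation be := (beta t).
Local Notation et := (eta t).
Variables (x y v g vt theta : 'cV[R]_d).
Local Notation G := (gradient q y).
Let w := (1 - be) *: v + be *: y.
Let v' c := w - et *: (Pinv c *m g).
Let x' c := y + al *: (Pinv c *m Pi *m (v' c - w)).
Hypothesis yE : y = (1 - al) *: x + al *: w.
(* [As 0] may be negative; the first step is saved by [x 0 = y 0]. *)
Hypothesis xy : 0 <= As t \/ x = y.
Hypothesis gG : forall i, g i 0 = G i 0 \/ Pi i i = 1.
Hypothesis vtE : forall i, vt i 0 = w i 0 - et / coord_prob p i * g i 0.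
Hypothesis sub_psi : forall i u,
  (g i 0 - G i 0) * (u - vt i 0) <= psi i u - psi i (vt i 0).

Lemma block_descent c : 0 < p c ->
  q (x' c) - q y <= al * et * (1 / 2 * sqnorm Pi (Pinv c *m g)
                               - bilform Pi (Pinv c *m G) (Pinv c *m g)).
Proof.
move=> pc; set z := Pinv c *m g.
set W := Pi *m Pinv c *m M *m Pinv c *m Pi.
have W_sym : W^T = W.
  rewrite /W trmx_mul ker_proj_tr trmx_mul Pinv_tr trmx_mul M_sym.
  by rewrite trmx_mul Pinv_tr ker_proj_tr !mulmxA.
have dx : x' c - y = - (al * et) *: (Pinv c *m (Pi *m z)).
  rewrite /x' (_ : v' c - w = - et *: z); last first.
    by rewrite /v' addrC addKr scaleNr.
  by rewrite addrC addKr -mulmxA -!scalemxAr scalerA mulrN.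
have GE u : ((gradient q y)^T *m Pi *m u) 0 0 = (G^T *m u) 0 0.
  by rewrite -{1}ker_proj_tr -trmx_mul (gradient_ker_proj _ q_diff q_lower).
apply: le_trans (q_upper _ _) _; rewrite GE dx.
have -> : (G^T *m (- (al * et) *: (Pinv c *m (Pi *m z)))) 0 0 =
    - (al * et) * bilform Pi (Pinv c *m G) z.
  by rewrite -scalemxAr mxE /bilform trmx_mul Pinv_tr !mulmxA.
rewrite !sqnormE bilformZl bilformZr.
have -> : bilform M (Pinv c *m (Pi *m z)) (Pinv c *m (Pi *m z)) =
    sqnorm W (Pi *m z).
  rewrite sqnormE /W 2!bilform_mulr -[Pi *m Pinv c *m M]mulmxA bilform_mull.
  by rewrite ker_proj_tr bilform_mull Pinv_tr (mulmxA Pi Pi) ker_proj_idem.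
have := rayleigh_le (Pi *m z) W_sym.
have -> : sqnorm 1%:M (Pi *m z) = sqnorm Pi z.
  by rewrite [RHS]bilform_ker_proj.
have := S_ge pc; rewrite -/W => S_geW.
have z0 : 0 <= sqnorm Pi z := sqnorm_ker_proj_ge0 A z.
move=> /le_trans /(_ (ler_wpM2r z0 S_geW)) le_W.
have k := coef_alpha_eta coefs t.
have k_gt0 : 0 < al * et.
  by rewrite mulr_gt0 ?(coef_alpha_gt0 coefs) ?(coef_eta_gt0 coefs).
have : (al * et) ^+ 2 * sqnorm W (Pi *m z) <= al * et * sqnorm Pi z.
  apply: le_trans (ler_wpM2l (sqr_ge0 _) le_W) _.
  by rewrite mulrA expr2 -[al * et * (al * et) * _]mulrA k mulr1.
by rewrite -[bilform Pi z z]/(sqnorm Pi z); lra.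
Qed.

Lemma block_energy c : 0 < p c ->
  Bs t.+1 * sqnorm Pi (v' c - theta) + 2 * As t.+1 * (q (x' c) - q y) <=
  Bs t.+1 * sqnorm Pi (w - theta)
  - 2 * a t.+1 * bilform Pi (Pinv c *m g) (w - theta)
  + 2 * a t.+1 * et * bilform Pi (Pinv c *m (g - G)) (Pinv c *m g).
Proof.
move=> pc; have := block_descent pc.
set z := Pinv c *m g; set zG := Pinv c *m G.
have -> : Pinv c *m (g - G) = z - zG by rewrite mulmxBr.
have -> : v' c - theta = (w - theta) - et *: z by rewrite /v' addrAC.
rewrite !sqnormE; move: (w - theta) => u.
rewrite !(bilformDl, bilformDr, bilformNl, bilformNr, bilformZl, bilformZr).
rewrite (bilformC u z) ?ker_proj_tr// => descent.
have A2 : 0 <= 2 * As t.+1.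
  by rewrite mulr_ge0// ltW// (coef_A_gt0 coefs).
apply: le_trans (lerD (lexx _) (ler_wpM2l A2 descent)) _.
rewrite le_eqVlt; apply/orP; left; apply/eqP.
rewrite -(coef_alphaM coefs).
transitivity (Bs t.+1 * bilform Pi u u - 2 * (Bs t.+1 * et) * bilform Pi z u
  + (Bs t.+1 * et) * et * bilform Pi z z + 2 * (As t.+1 * al) * et *
    (1 / 2 * bilform Pi z z - bilform Pi zG z)); first by ring.
by rewrite (coef_etaM coefs) (coef_alphaM coefs); field.
Qed.

(** On each coordinate either the defect vanishes or the projector acts as the identity, so the form
    is diagonal here. *)
Lemma bilform_defect (u : 'cV[R]_d) :
  bilform Pi (g - G) u = \sum_i (g i 0 - G i 0) * u i 0.
Proof.
rewrite bilformE; apply: eq_bigr => i _; rewrite [X in X * _]mxE [X in _ + X]mxE.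
by case: (gG i) => [->|/ker_proj_fix ->//]; rewrite subrr !mul0r.
Qed.

Lemma bilform_defect_Pinv c : bilform Pi (Pinv c *m (g - G)) (Pinv c *m g) =
  \sum_i (if i \in c then (g i 0 - G i 0) * g i 0 / coord_prob p i ^+ 2 else 0).
Proof.
rewrite bilformE; apply: eq_bigr => i _; rewrite PinvE.
rewrite [(g - G) i 0]mxE [X in (_ + X)]mxE.
case: ifP => ic; last by rewrite mul0r.
case: (gG i) => [->|/ker_proj_fix ->]; first by rewrite subrr !mul0r.
by rewrite PinvE ic; field; rewrite gt_eqF.
Qed.

(** [Pinv c *m g] is an unbiased estimate of [g]. In the quadratic term the factor 1 / p_i^2 occurs
    with probability p_i and leaves 1 / p_i, the step length appearing in [vtE]. *)
Lemma mean_energy :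
  \sum_c p c * (Bs t.+1 * sqnorm Pi (v' c - theta)
                + 2 * As t.+1 * (q (x' c) - q y)) <=
  Bs t.+1 * sqnorm Pi (w - theta) - 2 * a t.+1 * bilform Pi g (w - theta)
  + 2 * a t.+1 * et * \sum_i (g i 0 - G i 0) * g i 0 / coord_prob p i.
Proof.
apply: le_trans (_ : \sum_c p c *
  (Bs t.+1 * sqnorm Pi (w - theta)
   - 2 * a t.+1 * bilform Pi (Pinv c *m g) (w - theta)
   + 2 * a t.+1 * et * bilform Pi (Pinv c *m (g - G)) (Pinv c *m g)) <= _).
  apply: ler_sum => c _; have := p_ge0 c; rewrite le_eqVlt => /predU1P[<-|pc].
    by rewrite !mul0r.
  by rewrite ler_pM2l// block_energy.
rewrite (eq_bigr (fun c => p c * (Bs t.+1 * sqnorm Pi (w - theta))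
    - 2 * a t.+1 * (p c * bilform Pi (Pinv c *m g) (w - theta))
    + 2 * a t.+1 * et * (p c * bilform Pi (Pinv c *m (g - G)) (Pinv c *m g))));
  last by move=> c _; ring.
rewrite big_split sumrB/= -!mulr_sumr -mulr_suml p_sum mul1r.
rewrite le_eqVlt; apply/orP; left; apply/eqP; congr (_ - _ * _ + _ * _).
  rewrite -{2}(mean_Pinv g) bilform_suml; apply: eq_bigr => c _.
  by rewrite bilformZl.
transitivity (\sum_c \sum_i p c * (if i \in c
    then (g i 0 - G i 0) * g i 0 / coord_prob p i ^+ 2 else 0)).
  by apply: eq_bigr => c _; rewrite bilform_defect_Pinv mulr_sumr.
rewrite exchange_big; apply: eq_bigr => i _; rewrite mean_coord mulr0 addr0.
by field; rewrite gt_eqF.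
Qed.

Lemma mean_smooth :
  \sum_c p c * (Bs t.+1 * sqnorm Pi (v' c - theta)
                + 2 * As t.+1 * (q (x' c) - q theta)) <=
  Bs t * sqnorm Pi (v - theta) + 2 * As t * (q x - q theta)
  + 2 * a t.+1 * \sum_i (psi i (theta i 0) - psi i (vt i 0)).
Proof.
rewrite (eq_bigr (fun c => p c * (Bs t.+1 * sqnorm Pi (v' c - theta)
    + 2 * As t.+1 * (q (x' c) - q y)) + p c * (2 * As t.+1 * (q y - q theta))));
  last by move=> c _; ring.
rewrite big_split/= -[X in _ + X <= _]mulr_suml p_sum mul1r.
apply: le_trans (lerD mean_energy (lexx _)) _.
have a0 : 0 < a t.+1 by exact: coef_a_gt0 coefs _.
have psi_le : - 2 * a t.+1 * bilform Pi (g - G) (w - theta)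
    + 2 * a t.+1 * et * (\sum_i (g i 0 - G i 0) * g i 0 / coord_prob p i) <=
    2 * a t.+1 * \sum_i (psi i (theta i 0) - psi i (vt i 0)).
  have -> : - 2 * a t.+1 * bilform Pi (g - G) (w - theta)
    + 2 * a t.+1 * et * (\sum_i (g i 0 - G i 0) * g i 0 / coord_prob p i) =
    2 * a t.+1 * \sum_i (g i 0 - G i 0) * (theta i 0 - vt i 0).
    rewrite bilform_defect -[2 * _ * et * _]mulrA mulNr mulNr -mulrN -mulrDr.
    congr (_ * _); rewrite -sumrN mulr_sumr -big_split; apply: eq_bigr => i _ /=.
    by rewrite vtE [(w - theta) i 0]mxE [(- theta) i 0]mxE; field; rewrite gt_eqF.
  rewrite ler_wpM2l ?mulr_ge0// ?(ltW a0)//; apply: ler_sum => i _; exact: sub_psi.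
have gE : bilform Pi g (w - theta) =
    bilform Pi G (w - theta) + bilform Pi (g - G) (w - theta).
  by rewrite -bilformDl [G + _]addrC subrK.
(* Convexity of the squared seminorm; the term in [y - theta] is cancelled later by the strong
   convexity part of [q_lower theta y]. *)
have conv : Bs t.+1 * sqnorm Pi (w - theta) <=
    Bs t * sqnorm Pi (v - theta) + sigma * a t.+1 * sqnorm Pi (y - theta).
  have -> : w - theta = (1 - be) *: (v - theta) + be *: (y - theta).
    rewrite !scalerBr addrACA -opprD -scalerDl subrK scale1r//.
  rewrite sqnorm_conv ?ker_proj_tr//.
  rewrite -(coef_beta_compl coefs t) -(coef_betaM coefs) -!mulrA -mulrDr.
  rewrite ler_wpM2l//; first by rewrite ltW// (coef_B_gt0 coefs).
  rewrite gerBl !mulr_ge0// ?sqnorm_ker_proj_ge0//.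
    exact: coef_beta_ge0 coefs sigma_ge0 B0_ge0 t.
  by rewrite subr_ge0; exact: coef_beta_le1 coefs sigma_ge0 B0_ge0 t.
(* Scaling [yE] by [As t.+1] gives a (w - y) = A_t (y - x). *)
have wE : a t.+1 * bilform Pi G (w - theta) =
    a t.+1 * bilform Pi G (y - theta) + As t * bilform Pi G (y - x).
  have : bilform Pi G y = (1 - al) * bilform Pi G x + al * bilform Pi G w.
    by rewrite {2}yE bilformDr !bilformZr.
  rewrite !bilformDr !bilformNr -(coef_alpha_compl coefs t) -(coef_alphaM coefs).
  by move=> ->; ring.
have lo_theta := q_lower theta y; have lo_x := q_lower x y.
have x_le : As t * (- bilform Pi G (y - x)) <= As t * (q x - q y).
  case: xy => [A0|->]; last by rewrite !subrr -(scale0r 0) bilformZr mul0r oppr0 mulr0.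
  rewrite ler_wpM2l//; apply: le_trans lo_x; rewrite -bilformNr opprB.
  by rewrite lerDl mulr_ge0 ?sqnorm_ker_proj_ge0// divr_ge0.
have th_le : a t.+1 * (- bilform Pi G (y - theta))
    + sigma / 2 * a t.+1 * sqnorm Pi (y - theta) <= a t.+1 * (q theta - q y).
  rewrite [sigma / 2 * _]mulrC -mulrA -mulrDr ler_wpM2l ?(ltW a0)//.
  apply: le_trans lo_theta; rewrite -bilformNr opprB.
  by rewrite -[y - theta]opprB !sqnormE bilformNl bilformNr opprK.
have AE := coef_A coefs t.
have -> : 2 * As t.+1 * (q y - q theta) =
    2 * As t * (q y - q theta) + 2 * a t.+1 * (q y - q theta).
  by rewrite AE; ring.
rewrite gE; lra.
Qed.

End step.
End block_step.

(** * The Lyapunov function along a run *)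

(** The surrogate value undergoes the same affine update as the coordinate of [x], with [f] applied
    to the points [v] and [v']. *)
Definition average_next {R : realType} (f : R -> R) (alpha beta r h v v' : R) : R :=
  let lam := (1 - alpha) / (1 - alpha * beta) in
  let yh := lam * h + (1 - lam) * f v in
  yh + alpha / r * (f v' - ((1 - beta) * f v + beta * yh)).

(* Upper bound on [f (x t)] obtained by expanding [x t] over [v 0, ..., v t]. *)
Fixpoint average_bound {R : realType} (f : R -> R) (alpha beta : nat -> R) (r : R)
    (v : nat -> R) (t : nat) : R :=
  if t is s.+1 then
    average_next f (alpha s) (beta s) r (average_bound f alpha beta r v s)
      (v s) (v s.+1)
  else f (v 0%N).

Lemma average_bound0 {R : realType} (alpha beta : nat -> R) (r : R)
    (v : nat -> R) t : average_bound (cst 0) alpha beta r v t = 0.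
Proof. by elim: t => //= t ->; rewrite /average_next /=; ring. Qed.

Lemma eq_average_bound {R : realType} (f : R -> R) (alpha beta : nat -> R) (r : R)
    (v w : nat -> R) t : (forall s, (s <= t)%N -> v s = w s) ->
  average_bound f alpha beta r v t = average_bound f alpha beta r w t.
Proof.
elim: t => [|t IH] vw /=; first by rewrite vw.
by rewrite IH ?vw// => s st; apply: vw; rewrite (leq_trans st).
Qed.

Lemma mixture_solve {R : realFieldType} (al be r x v y : R) :
  0 <= al -> 0 <= be -> 0 < r <= 1 -> al <= r * (1 - be) ->
  y = (1 - al) * x + al * ((1 - be) * v + be * y) ->
  y = (1 - al) / (1 - al * be) * x + (1 - (1 - al) / (1 - al * be)) * v.
Proof.
move=> al0 be0 /andP[r0 r1] al_le yE.
have k_gt0 : 0 < 1 - al * be.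
  have be1 : 0 <= 1 - be by rewrite -(pmulr_rge0 _ r0) (le_trans al0).
  have : al <= 1 - be by apply: le_trans al_le _; rewrite ler_piMl.
  nra.
have k_neq0 : 1 - al * be != 0 by rewrite gt_eqF.
apply: (mulfI k_neq0); transitivity ((1 - al) * x + al * (1 - be) * v).
  by rewrite mulrBl mul1r {1}yE; ring.
by field.
Qed.

Section run.
Context {R : realType} {m d : nat} (A : 'M[R]_(m, d)) (q : 'cV[R]_d -> R).
Context (psi : 'I_d -> R -> R) (sigma S : R) (M : 'M[R]_d) (p : {set 'I_d} -> R).
Context (a As Bs alpha beta eta : nat -> R).
Local Notation Pi := (ker_proj A).
Local Notation Pinv c := (pseudoinv (block_mx_of p c)).
Hypothesis q_diff : forall z, differentiable (q : 'cV[R]_d -> R^o) z.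
Hypothesis psi_convex : forall i, convex_function (E := R^o) setT (psi i).
Hypothesis sigma_ge0 : 0 <= sigma.
Hypothesis q_lower : forall z w,
  q z - q w >= ((gradient q w)^T *m Pi *m (z - w)) 0 0
               + sigma / 2 * sqnorm Pi (z - w).
Hypothesis M_sym : M^T = M.
Hypothesis q_upper : forall z w,
  q z - q w <= ((gradient q w)^T *m Pi *m (z - w)) 0 0
               + 1 / 2 * sqnorm M (z - w).
Hypothesis R_or_psi : forall i, Pi i i = 1 \/ psi i = cst 0.
Hypothesis p_ge0 : forall c, 0 <= p c.
Hypothesis p_sum : \sum_c p c = 1.
Hypothesis p_gt0 : forall i, 0 < coord_prob p i.
Hypothesis S_ge : forall c : {set 'I_d}, 0 < p c ->
  S ^+ 2 >= lambda_max (Pi *m Pinv c *m M *m Pinv c *m Pi).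
Hypothesis coefs : apcg_coefficients sigma S a As Bs alpha beta eta.
Hypothesis B0_ge0 : 0 <= Bs 0%N.
Hypothesis step_cond : forall t i, psi i <> cst 0 ->
  1 - beta t - alpha t / coord_prob p i >= 0.

Let prox_eta_gt0 t i : 0 < eta t * (coord_prob p i)^-1.
Proof. by rewrite divr_gt0// (coef_eta_gt0 coefs). Qed.

Definition block_point (w vt : 'cV[R]_d) (c : {set 'I_d}) : 'cV[R]_d :=
  \col_i (if i \in c then vt i 0 else w i 0).

Definition primal_point (y w v' : 'cV[R]_d) (al : R) (c : {set 'I_d}) :
    'cV[R]_d :=
  y + al *: (Pinv c *m Pi *m (v' - w)).

Definition energy (theta : 'cV[R]_d) (t : nat) (x v : 'cV[R]_d) (h : 'I_d -> R) :
    R :=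
  Bs t * sqnorm Pi (v - theta)
  + 2 * As t * (q x + \sum_i h i - composite q psi theta).

(** [vt] is the virtual update of every coordinate. It does not depend on the block, which only
    selects the coordinates that receive it, so each mean splits by coordinate. *)
Lemma lyapunov_step t (x y v vt theta : 'cV[R]_d) (h : 'I_d -> R)
    (w := (1 - beta t) *: v + beta t *: y) :
  y = (1 - alpha t) *: x + alpha t *: w -> 0 <= As t \/ x = y ->
  (forall i, is_prox (eta t * (coord_prob p i)^-1) (psi i)
    (w i 0 - eta t / coord_prob p i * gradient q y i 0) (vt i 0)) ->
  (forall i, psi i = cst 0 -> h i = 0) ->
  (forall i, psi i <> cst 0 -> averages (psi i)
    (prox_weight alpha (coord_prob p i) t) (v i 0) (x i 0) (h i)) ->
  \sum_c p c * energy theta t.+1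
      (primal_point y w (block_point w vt c) (alpha t) c) (block_point w vt c)
      (fun i => average_next (psi i) (alpha t) (beta t) (coord_prob p i) (h i)
                  (v i 0) (block_point w vt c i 0))
  <= energy theta t x v h.
Proof.
move=> yE xy prox h0 avg; set G := gradient q y in prox.
pose g : 'cV[R]_d := \col_i (coord_prob p i / eta t * (w i 0 - vt i 0)).
have p0 i : coord_prob p i != 0 by rewrite gt_eqF.
have e0 : eta t != 0 by rewrite gt_eqF// (coef_eta_gt0 coefs).
have vtE i : vt i 0 = w i 0 - eta t / coord_prob p i * g i 0.
  by rewrite [g i 0]mxE; field; rewrite e0 p0.
have sub_psi i u : (g i 0 - G i 0) * (u - vt i 0) <= psi i u - psi i (vt i 0).
  have := prox_subgradient u (psi_convex i) (prox_eta_gt0 t i) (prox i).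
  congr (_ <= _); congr (_ * _); rewrite [g i 0]mxE; field.
  by rewrite e0 p0.
have gG i : g i 0 = G i 0 \/ Pi i i = 1.
  have [->|psi0] := R_or_psi i; [by right|left].
  (* For a zero [psi i] this test point bounds the square of the defect by 0. *)
  have := sub_psi i (vt i 0 + (g i 0 - G i 0)).
  rewrite psi0 /= subrr [vt i 0 + _]addrC addrK -expr2 => sq_le0.
  by apply/eqP; rewrite -subr_eq0 -sqrf_eq0 eq_le sq_le0 sqr_ge0.
have vE c : block_point w vt c = w - eta t *: (Pinv c *m g).
  apply/colP => i; rewrite [LHS]mxE vtE /w !cVE PinvE//.
  by case: ifP => _; ring.
have smooth := mean_smooth q_diff sigma_ge0 q_lower M_sym q_upper p_ge0 p_sum p_gt0
  S_ge coefs B0_ge0 theta yE xy gG vtE sub_psi.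
have mean_psi i : \sum_c p c * average_next (psi i) (alpha t) (beta t)
      (coord_prob p i) (h i) (v i 0) (block_point w vt c i 0) <=
    (1 - alpha t) * h i + alpha t * psi i (vt i 0).
  have -> : \sum_c p c * average_next (psi i) (alpha t) (beta t)
      (coord_prob p i) (h i) (v i 0) (block_point w vt c i 0) =
    \sum_c p c * (if i \in c
      then average_next (psi i) (alpha t) (beta t) (coord_prob p i) (h i)
             (v i 0) (vt i 0)
      else average_next (psi i) (alpha t) (beta t) (coord_prob p i) (h i)
             (v i 0) (w i 0)).
    by apply: eq_bigr => c _; rewrite mxE; case: ifP.
  rewrite (mean_coord p_sum); have [psi0|psi_neq0] := pselect (psi i = cst 0).
    by rewrite h0// psi0 /average_next/= !(mulr0, addr0, subr0).
  have st s := step_cond s psi_neq0.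
  have r_le1 := coord_prob_le1 p_ge0 p_sum i.
  have wE : w i 0 = (1 - beta t) * v i 0 + beta t * y i 0.
    by rewrite !cVE.
  have yiE : y i 0 = (1 - alpha t) / (1 - alpha t * beta t) * x i 0
      + (1 - (1 - alpha t) / (1 - alpha t * beta t)) * v i 0.
    apply: (@mixture_solve _ _ _ (coord_prob p i)).
    - exact/ltW/(coef_alpha_gt0 coefs sigma_ge0 B0_ge0).
    - exact: coef_beta_ge0 coefs sigma_ge0 B0_ge0 t.
    - by rewrite p_gt0.
    - exact: step_alpha_le.
    - by rewrite {1}yE !cVE.
  have be01 : 0 <= beta t <= 1.
    rewrite (coef_beta_ge0 coefs sigma_ge0 B0_ge0).
    exact: coef_beta_le1 coefs sigma_ge0 B0_ge0 t.
  rewrite wE [X in beta t * X]yiE.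
  exact: (averages_mean (psi_convex i) (coef_alpha_gt0 coefs sigma_ge0 B0_ge0 t)
    be01 (p_gt0 i) r_le1 (step_alpha_le (p_gt0 i) st t)
    (prox_weight_itv coefs sigma_ge0 B0_ge0 (p_gt0 i) st t) (avg _ psi_neq0)).
rewrite /energy /composite; pose hn c i := average_next (psi i) (alpha t) (beta t)
  (coord_prob p i) (h i) (v i 0) (block_point w vt c i 0).
rewrite (eq_bigr (fun c => p c * (Bs t.+1 * sqnorm Pi (block_point w vt c - theta)
    + 2 * As t.+1 *
      (q (primal_point y w (block_point w vt c) (alpha t) c) - q theta))
  + 2 * As t.+1 * (p c * \sum_i hn c i)
  - p c * (2 * As t.+1 * \sum_i psi i (theta i 0))));
  last by move=> c _; rewrite /hn/=; ring.
rewrite sumrB big_split/= -mulr_suml p_sum mul1r -mulr_sumr.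
have le1 : \sum_c p c * (Bs t.+1 * sqnorm Pi (block_point w vt c - theta)
    + 2 * As t.+1 *
      (q (primal_point y w (block_point w vt c) (alpha t) c) - q theta)) <=
  Bs t * sqnorm Pi (v - theta) + 2 * As t * (q x - q theta)
  + 2 * a t.+1 * \sum_i (psi i (theta i 0) - psi i (vt i 0)).
  by apply: le_trans smooth; apply: ler_sum => c _; rewrite /primal_point !vE.
have le2 : 2 * As t.+1 * (\sum_c p c * \sum_i hn c i) <=
  2 * As t.+1 * \sum_i ((1 - alpha t) * h i + alpha t * psi i (vt i 0)).
  rewrite ler_wpM2l//.
    by rewrite mulr_ge0// ltW// (coef_A_gt0 coefs).
  under eq_bigr do rewrite mulr_sumr.
  by rewrite exchange_big; apply: ler_sum => i _; exact: mean_psi.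
apply: le_trans (lerB (lerD le1 le2) (lexx _)) _.
rewrite le_eqVlt; apply/orP; left; apply/eqP.
rewrite sumrB big_split/= -!mulr_sumr.
rewrite -(coef_alpha_compl coefs t) -(coef_alphaM coefs); ring.
Qed.

Section one_run.
Variables (b : nat -> {set 'I_d}) (x y v vh : nat -> 'cV[R]_d).
Hypothesis run : apcg_run A q psi p alpha beta eta b x y v vh.
Local Notation w t := ((1 - beta t) *: v t + beta t *: y t).

(** The implicit form of the definition of [y]. The denominator is nonzero from index 1 on, where
    [alpha < 1]; at index 0 all points are 0. *)
Lemma run_convex t : y t = (1 - alpha t) *: x t + alpha t *: w t.
Proof.
case: t => [|t].
  by rewrite (run_x0 run) (run_y0 run) (run_v0 run) !(scaler0, addr0).
have k : 1 - alpha t.+1 * beta t.+1 != 0.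
  rewrite gt_eqF// subr_gt0.
  have := coef_alpha_lt1 coefs sigma_ge0 B0_ge0 t; apply: le_lt_trans.
  rewrite ler_piMr//; first exact/ltW/(coef_alpha_gt0 coefs sigma_ge0 B0_ge0).
  exact: coef_beta_le1 coefs sigma_ge0 B0_ge0 _.
have := congr1 ( *:%R (1 - alpha t.+1 * beta t.+1)) (run_y run t.+1).
rewrite scalerA divff// scale1r => E.
by rewrite scalerDr !scalerA addrA -E -scalerDl subrK scale1r.
Qed.

Lemma run_out t i : i \notin b t -> v t.+1 i 0 = w t i 0.
Proof.
move=> ib; rewrite (run_v_out run)// (run_vh run) mxE [X in _ + X = _]mxE.
by rewrite [X in _ - X = _]mxE PinvE// (negbTE ib) mulr0 subr0.
Qed.

Lemma run_in t i : i \in b t ->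
  is_prox (eta t * (coord_prob p i)^-1) (psi i)
    (w t i 0 - eta t / coord_prob p i * gradient q (y t) i 0) (v t.+1 i 0).
Proof.
move=> ib; have := run_v_in run ib; congr is_prox.
rewrite (run_vh run) !cVE PinvE// ib.
by rewrite mulrA mulrAC.
Qed.

Lemma run_primal t :
  x t.+1 = primal_point (y t) (w t) (v t.+1) (alpha t) (b t).
Proof. by rewrite (run_x run) /primal_point opprD addrA. Qed.

Lemma run_averages t i : psi i <> cst 0 ->
  averages (psi i) (prox_weight alpha (coord_prob p i) t) (v t i 0) (x t i 0)
    (average_bound (psi i) alpha beta (coord_prob p i) (fun s => v s i 0) t).
Proof.
move=> psi_neq0; have st s := step_cond s psi_neq0.
have Pii : Pi i i = 1 by case: (R_or_psi i).
elim: t => [|t IH].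
  exists (v 0%N i 0), (psi i (v 0%N i 0)).
  by split; rewrite //= subrr mul0r add0r mul1r ?(run_v0 run) ?(run_x0 run).
(* One formula covers both cases: on an undrawn coordinate [v t.+1] equals [w t] and the increment
   is 0. *)
have -> : x t.+1 i 0 = y t i 0 + alpha t / coord_prob p i *
    (v t.+1 i 0 - (1 - beta t) * v t i 0 - beta t * y t i 0).
  rewrite run_primal !cVE -mulmxA PinvE// ker_proj_fix//.
  have wE : w t i 0 = (1 - beta t) * v t i 0 + beta t * y t i 0.
    by rewrite !cVE.
  rewrite !cVE -wE.
  have [ib|ib] := boolP (i \in b t); first by rewrite wE; ring.
  by rewrite run_out// wE; ring.
have r_le1 := coord_prob_le1 p_ge0 p_sum i.
have be01 : 0 <= beta t <= 1.
  rewrite (coef_beta_ge0 coefs sigma_ge0 B0_ge0).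
  exact: coef_beta_le1 coefs sigma_ge0 B0_ge0 t.
have al_gt0 := coef_alpha_gt0 coefs sigma_ge0 B0_ge0 t.
rewrite (@mixture_solve _ (alpha t) (beta t) (coord_prob p i) (x t i 0) (v t i 0)
  (y t i 0)).
- exact: (averages_step (psi_convex i) al_gt0
    be01 (p_gt0 i) r_le1 (step_alpha_le (p_gt0 i) st t)
    (prox_weight_itv coefs sigma_ge0 B0_ge0 (p_gt0 i) st t)
    (prox_weight_step coefs sigma_ge0 B0_ge0 (p_gt0 i) r_le1 st t) IH).
- exact: ltW.
- by case/andP: be01.
- by rewrite p_gt0.
- exact: step_alpha_le.
- by rewrite {1}run_convex !cVE.
Qed.

End one_run.
End run.

(** Proximal points are unique, so each step is a function of the current state and block.
    Measurability of the iterates rests on this. *)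
Lemma run_deterministic {R : realType} {m d : nat} (A : 'M[R]_(m, d))
    (q : 'cV[R]_d -> R) (psi : 'I_d -> R -> R) (p : {set 'I_d} -> R)
    (alpha beta eta : nat -> R) (b b' : nat -> {set 'I_d})
    (x y v vh x' y' v' vh' : nat -> 'cV[R]_d) :
  (forall i, convex_function (E := R^o) setT (psi i)) ->
  (forall i, 0 < coord_prob p i) -> (forall t, 0 < eta t) ->
  apcg_run A q psi p alpha beta eta b x y v vh ->
  apcg_run A q psi p alpha beta eta b' x' y' v' vh' ->
  forall t, (forall s, (s < t)%N -> b s = b' s) ->
  forall s, (s <= t)%N -> x s = x' s /\ v s = v' s.
Proof.
move=> psi_convex p_gt0 eta_gt0 run run'; elim=> [|t IH] bb' s.
  rewrite leqn0 => /eqP ->; rewrite (run_x0 run) (run_x0 run').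
  by rewrite (run_v0 run) (run_v0 run').
have {}IH := IH (fun s st => bb' s (ltnW st)).
rewrite leq_eqVlt => /predU1P[->|]; last exact: IH.
have [xt vt] := IH t (leqnn t).
have yt : y t = y' t by rewrite (run_y run) (run_y run') xt vt.
have bt : b t = b' t by exact: bb'.
have vt1 : v t.+1 = v' t.+1.
  apply/colP => i; have [ib|ib] := boolP (i \in b t).
    apply: prox_uniq (psi_convex i) _ (run_in p_gt0 run ib) _.
      by rewrite divr_gt0.
    by rewrite vt yt; apply: (run_in p_gt0 run'); rewrite -bt.
  by rewrite (run_out p_gt0 run ib) (run_out p_gt0 run') ?vt ?yt// -bt.
by split=> //; rewrite (run_primal run) (run_primal run') vt1 vt yt bt.
Qed.

(** * Expectations over finite histories *)

Section discrete_expectation.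
Context {R : realType} {dO : measure_display} {Omega : measurableType dO}.
Context (P : probability Omega R).
Implicit Types (X Y : Omega -> R).

Definition mass {T : Type} (H : Omega -> T) (k : T) : R :=
  fine (P [set w | H w = k]).

Lemma mass_ge0 {T : Type} (H : Omega -> T) (k : T) : 0 <= mass H k.
Proof. exact: fine_ge0. Qed.

Lemma expectation_discrete {T : finType} (H : Omega -> T) (f : T -> R) :
  (forall k, measurable [set w | H w = k]) ->
  ('E_P[f \o H])%E = (\sum_k f k * mass H k)%:E.
Proof.
move=> mH.
have intI k : P.-integrable setT (fun w => (\1_[set w | H w = k] w)%:E).
  exact: integrable_indic.
rewrite unlock (eq_integral (fun w => \sum_k (f k)%:E * (\1_[set w | H w = k] w)%:E)%E);
  last first.
  move=> w _; rewrite (bigD1 (H w))//= big1 ?adde0; last first.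
    move=> k kH; rewrite indicE memNset ?mule0//= => E.
    by rewrite E eqxx in kH.
  by rewrite indicE mem_set// mule1.
rewrite integral_sum//; last by move=> k; exact: integrableZl.
rewrite -sumEFin; apply: eq_bigr => k _.
rewrite integralZl// integral_indic// setIT EFinM; congr (_ * _)%E.
by rewrite fineK// fin_num_measure.
Qed.

Lemma sum_mass {T : finType} (H : Omega -> T) :
  (forall k, measurable [set w | H w = k]) -> \sum_k mass H k = 1.
Proof.
move=> mH; apply: EFin_inj; have := expectation_discrete (cst 1) mH.
rewrite (_ : cst 1 \o H = cst 1)// expectation_cst => ->; congr EFin.
by apply: eq_bigr => k _; rewrite mul1r.
Qed.

Lemma factor_through {T : Type} (H : Omega -> T) X :
  (forall w w', H w = H w' -> X w = X w') -> exists f, X = f \o H.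
Proof.
move=> HX; exists (fun k => if pselect (exists w, H w = k) is left e
  then X (projT1 (cid e)) else 0).
apply/funext => w /=; case: pselect => [e|[]]; last by exists w.
by apply: HX; rewrite (projT2 (cid e)).
Qed.

Lemma mass_gt0 {T : Type} (H : Omega -> T) (k : T) : 0 < mass H k ->
  exists w, H w = k.
Proof.
rewrite /mass => k0; apply/not_existsP => nk; move: k0.
rewrite (_ : [set w | H w = k] = set0) ?measure0 ?ltxx//.
by apply/seteqP; split=> // w /= /nk.
Qed.

(* [H] is the past and [C] a fresh independent draw of law [pr]: a conditional
   one-step inequality integrates. *)
Lemma expectation_step {T U : finType} (H : Omega -> T) (C : Omega -> U)
    (pr : U -> R) X Y :
  (forall k, measurable [set w | H w = k]) ->
  (forall c, measurable [set w | C w = c]) ->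
  (forall k c, P [set w | H w = k /\ C w = c] =
               (P [set w | H w = k] * (pr c)%:E)%E) ->
  (forall w w', H w = H w' -> X w = X w') ->
  (forall w0, 0 < mass H (H w0) -> exists g : U -> R,
     (forall w, H w = H w0 -> Y w = g (C w)) /\ \sum_c pr c * g c <= X w0) ->
  (forall w w', H w = H w' -> C w = C w' -> Y w = Y w') ->
  ('E_P[Y] <= 'E_P[X])%E.
Proof.
move=> mH mC HC HX step HY.
pose HC' w := (H w, C w).
have mHC k : measurable [set w | HC' w = k].
  rewrite (_ : [set w | HC' w = k] = [set w | H w = k.1] `&` [set w | C w = k.2]).
    exact: measurableI.
  by apply/seteqP; split => w /=; [move=> <-|case: k => k c [/= <- <-]].
have [f XE] := factor_through HX.
have [g YE] := @factor_through _ HC' Y (fun w w' e =>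
  HY w w' (congr1 fst e) (congr1 snd e)).
have massE k c : mass HC' (k, c) = mass H k * pr c.
  rewrite /mass (_ : [set w | HC' w = (k, c)] = [set w | H w = k /\ C w = c]).
    by rewrite HC fineM// fin_num_measure.
  by apply/seteqP; split => w /=; [move=> [<- <-]|move=> [<- <-]].
rewrite XE YE !expectation_discrete// lee_fin.
rewrite (eq_bigr (fun kc => g (kc.1, kc.2) * (mass H kc.1 * pr kc.2))); last first.
  by move=> [k c] _ /=; rewrite massE.
rewrite -(pair_bigA _ (fun k c => g (k, c) * (mass H k * pr c)))/=.
apply: ler_sum => k _; have := mass_ge0 H k.
rewrite le_eqVlt => /predU1P[<-|k_gt0].
  by rewrite mulr0 big1// => c _; rewrite mul0r mulr0.
have [w0 w0k] := mass_gt0 k_gt0; have := step w0; rewrite w0k => /(_ k_gt0).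
move=> [g' [g'Y le_g']].
rewrite (eq_bigr (fun c => (pr c * g (k, c)) * mass H k)); last by move=> c _; ring.
rewrite -mulr_suml ler_pM2r//.
have -> : f k = X w0 by rewrite XE /= w0k.
(* [g] and [g'] agree at every [c] that occurs together with [k]; the other values of [c] have
   probability 0. *)
apply: le_trans le_g'; rewrite le_eqVlt; apply/orP; left; apply/eqP.
apply: eq_bigr => c _; have := mass_ge0 HC' (k, c).
rewrite massE pmulr_rge0// le_eqVlt => /predU1P[<-|c_gt0]; first by rewrite !mul0r.
have [w [wk wc]] : exists w, HC' w = (k, c).
  by apply: mass_gt0; rewrite massE mulr_gt0.
by rewrite -wc -g'Y ?wk// YE /= /HC' wk.
Qed.

End discrete_expectation.

Section block_history.
Context {R : realType} {dO : measure_display} {Omega : measurableType dO}.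
Context {P : probability Omega R} {d : nat} {p : {set 'I_d} -> R}.
Context {b : nat -> Omega -> {set 'I_d}}.
Hypothesis b_sampling : block_sampling P p b.

Definition history (t : nat) (w : Omega) : {ffun 'I_t -> {set 'I_d}} :=
  [ffun s : 'I_t => b s w].

Lemma historyP t w w' :
  history t w = history t w' <-> forall s, (s < t)%N -> b s w = b s w'.
Proof.
split=> [/ffunP e s st|e]; first by have := e (Ordinal st); rewrite !ffunE.
by apply/ffunP => s; rewrite !ffunE e.
Qed.

Lemma measurable_history t k : measurable [set w | history t w = k].
Proof.
rewrite (_ : [set w | history t w = k] =
    \bigcap_(s in [set: 'I_t]) [set w | b s w = k s]).
  apply: fin_bigcap_measurable => [|s _]; first exact: finite_finset.
  exact: block_measurable b_sampling _ _.
apply/seteqP; split => w /= => [<- s _|e]; first by rewrite /= ffunE.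
by apply/ffunP => s; rewrite ffunE; exact: e.
Qed.

Lemma block_law_ge0 c : 0 <= p c.
Proof. by rewrite -lee_fin -(block_law b_sampling 0 c). Qed.

Lemma block_law_sum : \sum_c p c = 1.
Proof.
rewrite -(@sum_mass _ _ _ P _ (b 0%N)); last exact: block_measurable b_sampling _.
by apply: eq_bigr => c _; rewrite /mass (block_law b_sampling).
Qed.

Lemma history_indep t k c : P [set w | history t w = k /\ b t w = c] =
  (P [set w | history t w = k] * (p c)%:E)%E.
Proof.
(* The default value is the block at time [t], the first index outside the history. *)
pose h s := if insub s is Some i then k i else c.
have ht : h t = c by rewrite /h insubF// ltnn.
have hs (s : 'I_t) : h s = k s by rewrite /h valK.
have histE : [set w | history t w = k] =
    [set w | forall s, (s < t)%N -> b s w = h s].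
  apply/seteqP; split => w /= => [wk s st|e].
    by rewrite (hs (Ordinal st)) -wk ffunE.
  by apply/ffunP => s; rewrite ffunE e ?hs.
have -> : [set w | history t w = k /\ b t w = c] =
    [set w | forall s, (s <= t)%N -> b s w = h s].
  apply/seteqP; split => w /=.
    move=> [wk wc] s; rewrite leq_eqVlt => /predU1P[->|]; first by rewrite ht.
    by move: s; have : [set w | history t w = k] w by []; rewrite histE.
  move=> e; split; last by rewrite -ht; exact: e.
  have : [set w | forall s, (s < t)%N -> b s w = h s] w.
    by move=> s /ltnW; exact: e.
  by rewrite -histE.
by rewrite (block_indep b_sampling) -histE ht (block_law b_sampling).
Qed.

(** Independence gives positive probability to the given past followed by a block containing [i], so
    some outcome realizes both. *)
Lemma history_hits t w0 i : 0 < coord_prob p i ->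
  0 < mass P (history t) (history t w0) ->
  exists w, history t w = history t w0 /\ i \in b t w.
Proof.
move=> pi_gt0 w0_gt0.
have [c ic c_gt0] : exists2 c : {set 'I_d}, i \in c & 0 < p c.
  apply: contrapT => nc; move: pi_gt0; rewrite /coord_prob big1 ?ltxx// => c ic.
  apply/eqP; rewrite eq_le block_law_ge0 andbT leNgt; apply/negP => c_gt0.
  by apply: nc; exists c.
pose HC w := (history t w, b t w).
have [w [wk wc]] : exists w, HC w = (history t w0, c).
  apply: (mass_gt0 (P := P)); rewrite /mass.
  rewrite (_ : [set w | HC w = (history t w0, c)] =
    [set w | history t w = history t w0 /\ b t w = c]).
    rewrite history_indep fineM ?fin_num_measure//; last exact: measurable_history.
    by rewrite mulr_gt0.
  by apply/seteqP; split => w /=; [move=> [-> ->]|move=> [? <-]; congr (_, _)].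
by exists w; rewrite wc.
Qed.

End block_history.

Theorem theorem5p2 (R : realType) (m d : nat) (A : 'M[R]_(m, d))
    (q : 'cV[R]_d -> R) (psi : 'I_d -> R -> R) (sigma : R) (M : 'M[R]_d)
    (dO : measure_display) (Omega : measurableType dO) (P : probability Omega R)
    (p : {set 'I_d} -> R) (b : nat -> Omega -> {set 'I_d})
    (S : R) (a As Bs alpha beta eta : nat -> R)
    (x y v vh : nat -> Omega -> 'cV[R]_d) (theta : 'cV[R]_d)
    (q_diff : forall z, differentiable (q : 'cV[R]_d -> R^o) z)
    (psi_convex : forall i, convex_function (E := R^o) setT (psi i))
    (sigma_ge0 : 0 <= sigma)
    (q_lower : forall z w,
      q z - q w >= ((gradient q w)^T *m ker_proj A *m (z - w)) 0 0
                   + sigma / 2 * sqnorm (ker_proj A) (z - w))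
    (M_sym : M^T = M)
    (q_upper : forall z w,
      q z - q w <= ((gradient q w)^T *m ker_proj A *m (z - w)) 0 0
                   + 1 / 2 * sqnorm M (z - w))
    (R_or_psi : forall i, ker_proj A i i = 1 \/ psi i = cst 0)
    (p_gt0 : forall i, 0 < coord_prob p i)
    (b_sampling : block_sampling P p b)
    (S_ge : forall c : {set 'I_d}, 0 < p c ->
      S ^+ 2 >= lambda_max (ker_proj A *m pseudoinv (block_mx_of p c) *m M
                            *m pseudoinv (block_mx_of p c) *m ker_proj A))
    (coefs : apcg_coefficients sigma S a As Bs alpha beta eta)
    (B0_ge0 : 0 <= Bs 0%N)
    (step_cond : forall t i, psi i <> cst 0 ->
      1 - beta t - alpha t / coord_prob p i >= 0)
    (run : forall w, apcg_run A q psi p alpha beta eta (b ^~ w)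
      (x ^~ w) (y ^~ w) (v ^~ w) (vh ^~ w))
    (theta_min : is_minimizer (composite q psi) theta) (t : nat) :
  ((Bs t)%:E * 'E_P[fun w => sqnorm (ker_proj A) (v t w - theta)]
   + (2 * As t)%:E * ('E_P[fun w => composite q psi (x t w)]
                      - (composite q psi theta)%:E)
   <= (Bs 0%N * sqnorm 1%:M (0 - theta)
       + 2 * As 0%N * (composite q psi 0 - composite q psi theta))%:E)%E.
Proof.
have p_ge0 := block_law_ge0 b_sampling; have p_sum := block_law_sum b_sampling.
have B_ge0 := coef_B_ge0 coefs sigma_ge0 B0_ge0.
have A_gt0 := coef_A_gt0 coefs sigma_ge0 B0_ge0.
have eta_gt0 := coef_eta_gt0 coefs sigma_ge0 B0_ge0.
have det s w w' : history (b := b) s w = history (b := b) s w' ->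
    forall r, (r <= s)%N -> x r w = x r w' /\ v r w = v r w'.
  by move=> /historyP e; exact: run_deterministic (run w) (run w') s e.
pose bound s w i := average_bound (psi i) alpha beta (coord_prob p i)
  (fun r => v r w i 0) s.
pose En s w := energy A q psi As Bs theta s (x s w) (v s w) (bound s w).
have bound_det s w w' : history (b := b) s w = history (b := b) s w' ->
    bound s w = bound s w'.
  move=> e; apply/funext => i; apply: eq_average_bound => r rs.
  by have [_ ->] := det _ _ _ e r rs.
have En_det s w w' : history (b := b) s w = history (b := b) s w' ->
    En s w = En s w'.
  move=> e; have [xE vE] := det _ _ _ e s (leqnn s).
  by rewrite /En xE vE (bound_det _ _ _ e).
have En_step s : ('E_P[En s.+1] <= 'E_P[En s])%E.
  apply: (@expectation_step _ _ _ P _ _ (history (b := b) s) (b s) p).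
  - exact: (measurable_history b_sampling (t := s)).
  - exact: block_measurable b_sampling s.
  - exact: (history_indep b_sampling (t := s)).
  - exact: En_det.
  - move=> w0 w0_gt0.
    pose z := (1 - beta s) *: v s w0 + beta s *: y s w0.
    have state w : history (b := b) s w = history (b := b) s w0 ->
        [/\ x s w = x s w0, v s w = v s w0 & y s w = y s w0].
      move=> e; have [xE vE] := det _ _ _ e s (leqnn s).
      by rewrite (run_y (run w)) (run_y (run w0)) xE vE.
    have prox_w w i : history (b := b) s w = history (b := b) s w0 ->
        i \in b s w -> is_prox (eta s * (coord_prob p i)^-1) (psi i)
        (z i 0 - eta s / coord_prob p i * gradient q (y s w0) i 0)
        (v s.+1 w i 0).
      move=> /state[_ vE yE] /(run_in p_gt0 (run w)).
      by rewrite vE yE.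
    (* Each coordinate borrows its proximal point from an outcome with the same past that draws
       it. *)
    have /choice[vt vtP] : forall i, exists u, is_prox
        (eta s * (coord_prob p i)^-1) (psi i)
        (z i 0 - eta s / coord_prob p i * gradient q (y s w0) i 0) u.
      move=> i; have [w [e iw]] := history_hits b_sampling (p_gt0 i) w0_gt0.
      by exists (v s.+1 w i 0); exact: prox_w.
    pose vtc : 'cV[R]_d := \col_i vt i.
    pose v' := block_point z vtc.
    exists (fun c => energy A q psi As Bs theta s.+1
      (primal_point A p (y s w0) z (v' c) (alpha s) c) (v' c)
      (fun i => average_next (psi i) (alpha s) (beta s) (coord_prob p i)
        (bound s w0 i) (v s w0 i 0) (v' c i 0))).
    split=> [w e|].
      have [xE vE yE] := state w e.
      have v'E : v s.+1 w = v' (b s w).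
        apply/colP => i; rewrite [RHS]mxE; case: ifPn => [iw|iw].
          rewrite [RHS]mxE; apply: prox_uniq (psi_convex i) _ _ (vtP i).
            by rewrite divr_gt0.
          exact: prox_w.
        by rewrite (run_out p_gt0 (run w) iw) vE yE.
      rewrite /En (run_primal (run w)) v'E vE yE; congr energy.
      apply/funext => i; rewrite /bound/= -/(bound s w i) (bound_det _ _ _ e).
      by rewrite vE v'E.
    apply: (lyapunov_step q_diff psi_convex sigma_ge0 q_lower M_sym q_upper R_or_psi
      p_ge0 p_sum p_gt0 S_ge coefs B0_ge0 step_cond).
    + exact: (run_convex sigma_ge0 coefs B0_ge0 (run w0) s).
    + case: (s) => [|s']; last by left; rewrite ltW.
      by right; rewrite (run_x0 (run w0)) (run_y0 (run w0)).
    + by move=> i; rewrite [vtc i 0]mxE; exact: vtP.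
    + by move=> i psi0; rewrite /bound psi0 average_bound0.
    + move=> i; exact: (run_averages psi_convex sigma_ge0 R_or_psi p_ge0 p_sum p_gt0
        coefs B0_ge0 step_cond (run w0) s).
  - move=> w w' e be; apply: En_det; apply/historyP => r.
    by rewrite ltnS leq_eqVlt => /predU1P[->//|]; move: r; apply/historyP.
have En_le s w : Bs s * sqnorm (ker_proj A) (v s w - theta)
    + 2 * As s * (composite q psi (x s w) - composite q psi theta) <= En s w.
  (* As [As 0] may be negative, the initial case needs equality of the surrogate with [psi], which
     holds because [x 0 = v 0]. *)
  rewrite lerD2l; case: s => [|s].
    rewrite le_eqVlt; apply/orP; left; apply/eqP; congr (_ * (_ - _)).
    congr (_ + _); apply: eq_bigr => i _; rewrite /bound/=.
    by rewrite (run_x0 (run w)) (run_v0 (run w)).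
  rewrite ler_wpM2l ?mulr_ge0 ?(ltW (A_gt0 s))// lerD2r lerD2l.
  apply: ler_sum => i _; have [psi0|psi_neq0] := pselect (psi i = cst 0).
    by rewrite /bound psi0 average_bound0.
  have st r := step_cond r i psi_neq0.
  apply: (averages_le (psi_convex i)
    (prox_weight_itv coefs sigma_ge0 B0_ge0 (p_gt0 i) st s.+1)).
  exact: (run_averages psi_convex sigma_ge0 R_or_psi p_ge0 p_sum p_gt0
    coefs B0_ge0 step_cond (run w) s.+1 psi_neq0).
have En0 : En 0%N = cst (Bs 0%N * sqnorm (ker_proj A) (0 - theta)
       + 2 * As 0%N * (composite q psi 0 - composite q psi theta)).
  apply/funext => w; rewrite /En /energy /bound/= (run_x0 (run w)) (run_v0 (run w)).
  by [].
have En_t : ('E_P[En t] <= (Bs 0%N * sqnorm 1%:M (0 - theta)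
       + 2 * As 0%N * (composite q psi 0 - composite q psi theta))%:E)%E.
  elim: (t) => [|s IH]; last exact: le_trans (En_step s) IH.
  rewrite En0 expectation_cst lee_fin lerD2r ler_wpM2l//.
  exact: sqnorm_ker_proj_le.
have mH k := measurable_history b_sampling (t := t) k.
have [e eE] := factor_through (En_det t).
have [n nE] : exists n, (fun w => sqnorm (ker_proj A) (v t w - theta)) =
    n \o history (b := b) t.
  by apply: factor_through => w w' /det/(_ t (leqnn t))[_ ->].
have [f fE] : exists f, (fun w => composite q psi (x t w)) =
    f \o history (b := b) t.
  by apply: factor_through => w w' /det/(_ t (leqnn t))[-> _].
apply: le_trans En_t; rewrite eE nE fE !expectation_discrete//.
rewrite -EFinB -!EFinM -EFinD lee_fin.
have thetaE : composite q psi theta =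
    \sum_k composite q psi theta * mass P (history (b := b) t) k.
  by rewrite -mulr_sumr sum_mass// mulr1.
rewrite [X in _ * (_ - X)]thetaE -sumrB !mulr_sumr.
(* Histories of positive mass come from an actual outcome, where the pointwise bound [En_le]
   applies; the others contribute 0. *)
rewrite -big_split; apply: ler_sum => k _ /=; have := mass_ge0 P (history (b := b) t) k.
rewrite le_eqVlt => /predU1P[<-|].
  by rewrite !(mulr0, subr0, addr0).
move=> k_gt0; have [w <-] := mass_gt0 k_gt0.
have := En_le t w; rewrite eE.
rewrite -[sqnorm _ _]/((fun w => sqnorm (ker_proj A) (v t w - theta)) w).
rewrite nE -[composite q psi (x t w)]/((fun w => composite q psi (x t w)) w) fE /=.
move=> /(ler_wpM2r (mass_ge0 P (history (b := b) t) (history (b := b) t w))).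
by congr (_ <= _); ring.
Qed.
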